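(* Suppose that $b$ and $\sigma$ satisfy the following conditions. (i) There exist constants $K_1,K_2>0$ such that for all $x,y\in\mathbb{R}^d$ and $\mu,\nu\in\mathcal{P}_2(\mathbb{R}^d)$, $$2\langle x-y,b(x,\mu)-b(y,\nu)\rangle+\|\sigma(x,\mu)-\sigma(y,\nu)\|^2\leq -K_1|x-y|^2+K_2\mathbb{W}_2(\mu,\nu)^2.$$ (ii) There exist constants $a_1,a_2>0$ and $q\geq 2$ such that for all $x\in\mathbb{R}^d$ and $\mu\in\mathcal{P}_2(\mathbb{R}^d)$, $$2\langle x,b(x,\mu)\rangle+(q-1)\|\sigma(x,\mu)\|^2\leq -a_1|x|^2+a_2\mathcal{W}_2(\mu)^2.$$ (iii) There exist constants $b_1,b_2>0$ such that for all $x\in\mathbb{R}^d$ and $\mu\in\mathcal{P}_2(\mathbb{R}^d)$, $$|b(x,\mu)|^2\leq b_1|x|^2+b_2\mathcal{W}_2(\mu)^2.$$ Assume $0<a_2<a_1$. Then, for any $j\in\mathbb{S}_N$, there exists a stepsize $\Delta_0\in(0,1)$ such that for any $\Delta\in(0,\Delta_0)$ the Euler-Maruyama numerical solution $Y^{j,N}_{t_k}$ is exponentially stable in the mean-square sense, i.e., $$\limsup_{k\to\infty}\frac{1}{k\Delta}\log\big(\mathbb{E}|Y^{j,N}_{t_k}|^2\big)\leq-\theta^*_\Delta,$$ where $\theta^*_\Delta$ is a positive constant (depending on $\Delta$) satisfying $\lim_{\Delta\to0}\theta^*_\Delta=a_1-a_2$.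
   Context: $(\Omega,\mathcal{F},(\mathcal{F}_t)_{t\ge0},\mathbb{P})$ is a complete filtered probability space satisfying the usual conditions. $|\cdot|$ is the Euclidean norm on $\mathbb{R}^d$ and $\|\cdot\|$ is the Frobenius norm on $\mathbb{R}^{d\times m}$. $\mathcal{P}_2(\mathbb{R}^d)$ is the set of probability measures on $\mathbb{R}^d$ with finite second moment, $\mathbb{W}_2$ is the 2-Wasserstein distance on it, and $\mathcal{W}_2(\mu)=\left(\int_{\mathbb{R}^d}|x|^2\mu(dx)\right)^{1/2}$. The coefficients $b:\mathbb{R}^d\times\mathcal{P}_2(\mathbb{R}^d)\to\mathbb{R}^d$ and $\sigma:\mathbb{R}^d\times\mathcal{P}_2(\mathbb{R}^d)\to\mathbb{R}^{d\times m}$ are Borel measurable and locally Lipschitz with respect to $x$. $X_0$ is a non-zero $\mathcal{F}_0$-measurable $\mathbb{R}^d$-valued random variable with $\mathbb{E}|X_0|^{p}<\infty$ for all $p\ge2$, and $W$ is an $m$-dimensional $(\mathcal{F}_t)$-Brownian motion. Let $N\geq 1$ be an integer, $\mathbb{S}_N=\{1,\dots,N\}$, and for $j\in\mathbb{S}_N$ let $(W^j,X_0^j)$ be independent copies of $(W,X_0)$. Stepsizes are of the form $\Delta=1/M$ with $M$ a positive integer, and $t_k=k\Delta$, $k=0,1,2,\dots$. The Euler-Maruyama scheme for the interacting particle system is $$Y^{j,N}_{t_{k+1}}=Y^{j,N}_{t_k}+b(Y^{j,N}_{t_k},\mu^{Y,N}_{t_k})\Delta+\sigma(Y^{j,N}_{t_k},\mu^{Y,N}_{t_k})\Delta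 W^j_{t_k},\qquad Y^{j,N}_0=X^j_0,\quad j\in\mathbb{S}_N,$$ where $\Delta W^j_{t_k}=W^j_{t_{k+1}}-W^j_{t_k}$ and $\mu^{Y,N}_{t_k}=\frac1N\sum_{i=1}^N\delta_{Y^{i,N}_{t_k}}$. Convention: $\log 0=-\infty$. *)

(* Defs.v *)
From HB Require Import structures.
From mathcomp Require Import all_boot all_order all_algebra.
From mathcomp Require Import all_classical all_reals all_analysis.
From mathcomp Require Import measurable_realfun.

Set Implicit Arguments.
Unset Strict Implicit.
Unset Printing Implicit Defensive.

Import Order.TTheory GRing.Theory Num.Theory.
Import numFieldNormedType.Exports.

Local Open Scope classical_set_scope.
Local Open Scope ring_scope.

(* The library gives matrices a topology but no sigma-algebra. *)
Notation borel T := (g_sigma_algebraType (@open T)).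

Section euclidean.
Context {R : realType}.

Definition dotp d (x y : 'cV[R]_d) : R := \sum_i x i 0 * y i 0.

(* The library's norm on matrices is the sup norm, hence these two. *)
Definition enorm d (x : 'cV[R]_d) : R := Num.sqrt (\sum_i x i 0 ^+ 2).

Definition frobenius d m (A : 'M[R]_(d, m)) : R :=
  Num.sqrt (\sum_i \sum_j A i j ^+ 2).

Lemma measurable_enorm2 d :
  measurable_fun [set: borel 'cV[R]_d]
    ((fun x => (enorm x ^+ 2)%:E) : borel 'cV[R]_d -> \bar R).
Proof.
apply/measurable_EFinP.
apply: (measurability _ (RGenOInfty.measurableE R)).
move=> _ [_ [r ->] <-]; rewrite setTI; apply: sub_sigma_algebra.
apply: (@open_comp 'cV[R]_d R); last exact: rray_open.
move=> x _; move: x; rewrite /enorm.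
rewrite (_ : (fun y : 'cV[R]_d => Num.sqrt (\sum_i y i 0 ^+ 2) ^+ 2) =
          (fun y : 'cV[R]_d => \sum_i y i 0 ^+ 2)); last first.
  by apply/funext => y; rewrite sqr_sqrtr// sumr_ge0// => i _; rewrite sqr_ge0.
apply: continuous_big => [|i _ x]; first exact: add_continuous.
apply: (@continuous_comp _ _ _ (fun y : 'cV[R]_d => y i 0) (fun r => r ^+ 2)).
  exact: coord_continuous.
exact: exprn_continuous.
Qed.

End euclidean.

Section wasserstein.
Context {R : realType} (d : nat).
Local Notation E := (borel 'cV[R]_d).

Record P2 := mkP2 {
  P2_prob :> probability E R ;
  P2_moment :
    (\int[P2_prob]_x (enorm (x : 'cV[R]_d) ^+ 2)%:E < +oo)%E }.

Definition moment2 (mu : P2) : R :=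
  Num.sqrt (fine (\int[mu]_x (enorm (x : 'cV[R]_d) ^+ 2)%:E)%E).

Definition coupling (mu nu : P2) (pi : probability (E * E)%type R) :=
  forall A : set E, measurable A ->
    pi (A `*` setT) = mu A /\ pi (setT `*` A) = nu A.

(* [fine] loses nothing: the product coupling has finite cost. *)
Definition W2 (mu nu : P2) : R :=
  Num.sqrt (fine (ereal_inf
    [set \int[pi]_z (enorm ((z.1 : 'cV[R]_d) - z.2) ^+ 2)%:E
      | pi in coupling mu nu]%E)).

(* The product of the Euclidean topology and the topology of [W2]. *)
Definition open_cV_P2 : set (set ('cV[R]_d * P2)) :=
  [set U | forall z, U z -> exists2 e : R, 0 < e &
    forall z', enorm (z.1 - z'.1) < e -> W2 z.2 z'.2 < e -> U z'].

Definition borel_coef p q (f : 'cV[R]_d -> P2 -> 'M[R]_(p, q)) :=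
  forall A : set (borel 'M[R]_(p, q)), measurable A ->
    <<s open_cV_P2 >> [set z | A (f z.1 z.2)].

Definition locally_lipschitz_x p q (f : 'cV[R]_d -> P2 -> 'M[R]_(p, q)) :=
  forall (mu : P2) (r : R), exists L : R, forall x y,
    enorm x <= r -> enorm y <= r ->
    frobenius (f x mu - f y mu) <= L * enorm (x - y).

End wasserstein.
Arguments P2 : clear implicits.

Section empirical.
Context {R : realType} (d N : nat) (hN : (1 <= N)%N) (y : 'I_N -> 'cV[R]_d).
Local Notation E := (borel 'cV[R]_d).

(* The hypothesis [1 <= N] is only used to make this a probability. *)
Definition empirical (A : set E) : \bar R :=
  ((N%:R^-1)%:E * \sum_(i < N) \d_(y i : E) A)%E.

Let dnat (k : nat) : {measure set E -> \bar R} :=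
  \d_(y (insubd (Ordinal hN) k) : E).

Let c : {nonneg R} := (N%:R^-1)%:nng.

Let empiricalE A : empirical A = mscale c (msum dnat N) A.
Proof.
rewrite /empirical /mscale /msum /=; congr (_ * _)%E.
by apply: eq_bigr => i _; rewrite /dnat valKd.
Qed.

Let empirical0 : empirical set0 = 0%E.
Proof. by rewrite empiricalE measure0. Qed.

Let empirical_ge0 A : (0 <= empirical A)%E.
Proof. by rewrite empiricalE measure_ge0. Qed.

Let empirical_sigma_additive : semi_sigma_additive empirical.
Proof.
have -> : empirical = mscale c (msum dnat N) by apply/funext/empiricalE.
exact: measure_semi_sigma_additive.
Qed.

HB.instance Definition _ := isMeasure.Build _ _ _ empirical
  empirical0 empirical_ge0 empirical_sigma_additive.

Let empirical_setT : empirical setT = 1%E.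
Proof.
rewrite /empirical; under eq_bigr do rewrite diracT.
rewrite sumEFin -EFinM sumr_const card_ord mulVf//.
by rewrite pnatr_eq0 -lt0n.
Qed.

HB.instance Definition _ :=
  Measure_isProbability.Build _ _ R empirical empirical_setT.

Lemma empirical_moment :
  (\int[empirical]_x (enorm (x : 'cV[R]_d) ^+ 2)%:E < +oo)%E.
Proof.
rewrite (eq_measure_integral (mscale c (msum dnat N))); last first.
  by move=> A _ _; exact: empiricalE.
have f0 (x : E) : [set: E] x -> (0 <= (enorm (x : 'cV[R]_d) ^+ 2)%:E)%E.
  by rewrite lee_fin sqr_ge0.
rewrite ge0_integral_mscale//; last exact: measurable_enorm2.
rewrite ge0_integral_measure_sum//; last exact: measurable_enorm2.
under eq_bigr.
  move=> i _; rewrite integral_dirac//; last exact: measurable_enorm2.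
  rewrite diracT mul1e; over.
by rewrite sumEFin -EFinM ltry.
Qed.

Definition empirical_P2 : P2 R d := mkP2 empirical_moment.

End empirical.

Section stochastic_basis.
Context {R : realType} {dO : measure_display} {Omega : measurableType dO}
  (P : probability Omega R).

(* Time is [0, +oo[: values of [F], and of the processes below, at negative
   times are irrelevant. *)
Definition usual_conditions (F : R -> set (set Omega)) :=
  [/\ measure_is_complete P,
      forall t, 0 <= t -> sigma_algebra setT (F t) /\ F t `<=` measurable,
      forall s t, 0 <= s -> s <= t -> F s `<=` F t,
      forall t, 0 <= t -> F t = \bigcap_(s in `]t, +oo[) F s
    & P.-negligible `<=` F 0].

Definition measurable_wrt d' (T : measurableType d') (G : set (set Omega))
    (X : Omega -> T) :=
  forall A, measurable A -> G (X @^-1` A).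

(* W_t - W_s is N(0, (t - s) I_m): its coordinates are independent
   N(0, t - s); [normal_prob] takes the standard deviation. *)
Definition brownian_motion m (F : R -> set (set Omega))
    (W : R -> Omega -> 'cV[R]_m) :=
  [/\ forall t, 0 <= t -> measurable_wrt (F t) (W t : Omega -> borel 'cV[R]_m),
      {ae P, forall w, W 0 w = 0},
      {ae P, forall w, {within `[0, +oo[, continuous (W ^~ w)}},
      forall s t, 0 <= s -> s < t ->
        forall B (A : set (borel 'cV[R]_m)), F s B -> measurable A ->
        P (B `&` [set w | A (W t w - W s w)]) =
        (P B * P [set w | A (W t w - W s w)%R])%E
    & forall s t, 0 <= s -> s < t ->
        forall A : 'I_m -> set R, (forall i, measurable (A i)) ->
        P [set w | forall i, A i ((W t w - W s w) i 0)] =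
        (\prod_i normal_prob 0 (Num.sqrt (t - s)) (A i))%E].

Definition iid_copies d' (T : measurableType d') N
    (Z : Omega -> T) (Zs : 'I_N -> Omega -> T) :=
  [/\ forall i, measurable_fun setT (Zs i),
      forall i A, measurable A -> P (Zs i @^-1` A) = P (Z @^-1` A)
    & forall A : 'I_N -> set T, (forall i, measurable (A i)) ->
        P [set w | forall i, A i (Zs i w)] =
        (\prod_i P (Zs i @^-1` A i))%E].

End stochastic_basis.

(* The state space of a pair (process, initial value), with the sigma-algebra
   generated by the evaluations at times t >= 0 and by the initial value. *)
Section driving_space.
Context (R : realType) (m d : nat).

Definition driving_cylinders : set (set ((R -> 'cV[R]_m) * 'cV[R]_d)) :=
  [set C | exists t (A : set (borel 'cV[R]_m)),
     [/\ 0 <= t, measurable A & C = [set z | A (z.1 t)]]] `|`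
  [set C | exists2 A : set (borel 'cV[R]_d),
     measurable A & C = [set z | A z.2]].

Definition driving_space := g_sigma_algebraType driving_cylinders.

End driving_space.

Definition driving {R : realType} {Omega : Type} m d
    (W : R -> Omega -> 'cV[R]_m) (X0 : Omega -> 'cV[R]_d) (w : Omega) :
  driving_space R m d := (W ^~ w, X0 w).

Section em_scheme.
Context {R : realType} {Omega : Type} (d m N : nat) (hN : (1 <= N)%N)
  (b : 'cV[R]_d -> P2 R d -> 'cV[R]_d)
  (sigma : 'cV[R]_d -> P2 R d -> 'M[R]_(d, m))
  (Ws : 'I_N -> R -> Omega -> 'cV[R]_m) (X0s : 'I_N -> Omega -> 'cV[R]_d)
  (Delta : R).

Fixpoint euler_maruyama (k : nat) (j : 'I_N) (w : Omega) : 'cV[R]_d :=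
  if k is k'.+1 then
    let y := euler_maruyama k' j w in
    let mu := empirical_P2 hN (fun i => euler_maruyama k' i w) in
    y + Delta *: b y mu
      + sigma y mu *m (Ws j (k'.+1%:R * Delta) w - Ws j (k'%:R * Delta) w)
  else X0s j w.

End em_scheme.

(* Main.v *)
(* Averaged over the particles, the second moments contract. Expanding the
   square of one Euler-Maruyama step, the term linear in the Brownian increment
   has mean zero and the quadratic one has mean at most
   Delta E ||sigma||^2, because the increment of particle j on [s, t] is
   independent of the history up to s of all the particles. By (ii), where
   q - 1 >= 1, and (iii),
     E |Y^j_(k+1)|^2 <= (1 - a1 Delta + b1 Delta^2) E |Y^j_k|^2
       + (a2 Delta + b2 Delta^2) (1/N) sum_i E |Y^i_k|^2 ,
   so that S_k := sum_i E |Y^i_k|^2 satisfies S_(k+1) <= exp(- theta Delta) S_k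
   with theta := a1 - a2 - (b1 + b2) Delta, and E |Y^j_k|^2 <= S_k. *)
From HB Require Import structures.
Require Import Defs.
From mathcomp Require Import all_boot all_order all_algebra.
From mathcomp Require Import all_classical all_reals all_analysis.
From mathcomp Require Import measurable_realfun ring lra.

Set Implicit Arguments.
Unset Strict Implicit.
Unset Printing Implicit Defensive.

Import Order.TTheory GRing.Theory Num.Theory.
Import numFieldNormedType.Exports.

Local Open Scope classical_set_scope.
Local Open Scope ring_scope.

(** * Integrable real functions on a probability space *)

(** The filtration governs only the pair (W, X0); the particles are known through the joint law of
    their driving pairs. Independence of an increment from the past is therefore transported: past
    events are sets of the state space of (path, initial value), pulled back along (W, X0), where
    they fall into F_s, and along every copy. Expectations are then computed by factorising products
    of independent variables, with no conditional expectation. A second obstacle is that the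
    coefficients see the random empirical measure, while their measurability refers to the topology
    of [W2]. Matching atoms with equal indices bounds [W2] between empirical measures, so the
    configuration determines (Y^j, mu) continuously and Y_k stays a function of the history.
    Adaptedness and finite second moments of all particles go through one induction, since each
    factorisation presupposes both. The variance of an increment is needed only from above, because
    it multiplies a nonnegative expectation; it is extracted from exponential moments. *)

Section real_integrable.
Context {d : measure_display} {T : measurableType d} {R : realType}.
Variable P : probability T R.
Implicit Types f g : T -> R.
Local Notation integ f := (P.-integrable setT (EFin \o f)).

Lemma measurable_integ f : integ f -> measurable_fun setT f.
Proof. by move=> /measurable_int/measurable_EFinP. Qed.

Lemma integ_le f g : measurable_fun setT f ->
  (forall w, `|f w| <= g w) -> integ g -> integ f.
Proof.
move=> mf fg; apply: le_integrable => //; first exact/measurable_EFinP.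
by move=> w _ /=; rewrite lee_fin (le_trans (fg w))// ler_norm.
Qed.

Lemma integD f g : integ f -> integ g -> integ (fun w => f w + g w).
Proof. by move=> If Ig; exact: (integrableD measurableT If Ig). Qed.

Lemma integZ (k : R) f : integ f -> integ (fun w => k * f w).
Proof. by move=> If; exact: (integrableZl measurableT k If). Qed.

Lemma integ_cst (k : R) : integ (fun=> k).
Proof. exact: finite_measure_integrable_cst. Qed.

Lemma Rintegral_prob_cst (k : R) : \int[P]_w k = k.
Proof.
rewrite Rintegral_cst// -[RHS]mulr1; congr (_ * _).
by have := probability_setT P => /(congr1 fine).
Qed.

Lemma integ_sum (I : Type) (s : seq I) (f : I -> T -> R) :
  (forall i, integ (f i)) -> integ (fun w => \sum_(i <- s) f i w).
Proof.
move=> If; elim: s => [|i s IH].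
  rewrite (_ : (fun _ => _) = fun=> 0); first exact: integ_cst.
  by apply/funext => w; rewrite big_nil.
rewrite (_ : (fun _ => _) = fun w => f i w + \sum_(j <- s) f j w).
  exact: integD.
by apply/funext => w; rewrite big_cons.
Qed.

Lemma Rintegral_sum (I : Type) (s : seq I) (f : I -> T -> R) :
  (forall i, integ (f i)) ->
  \int[P]_w (\sum_(i <- s) f i w) = \sum_(i <- s) \int[P]_w f i w.
Proof.
move=> If; elim: s => [|i s IH].
  rewrite big_nil (_ : (fun _ => _) = fun=> 0) ?Rintegral_cst ?mul0r//.
  by apply/funext => w; rewrite big_nil.
rewrite big_cons -IH -RintegralD//; last exact: integ_sum.
by apply: eq_Rintegral => w _; rewrite big_cons.
Qed.

Lemma integ_ge0 f : measurable_fun setT f -> (forall w, 0 <= f w) ->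
  (\int[P]_w (f w)%:E < +oo)%E -> integ f.
Proof.
move=> mf f0 foo; apply/integrableP; split; first exact/measurable_EFinP.
by under eq_integral do rewrite /= ger0_norm//.
Qed.

End real_integrable.

(** * Moments of a centred normal variable *)

Section normal_law.
Context {R : realType}.
Notation mu := (@lebesgue_measure R).

(** Change of variables holds for the Radon-Nikodym derivative; that derivative equals [normal_pdf]
    almost everywhere because both have the same integral over every measurable set. *)
Lemma ge0_integral_normal_prob (m s : R) (f : R -> \bar R) :
  measurable_fun setT f -> (forall x, 0 <= f x)%E ->
  (\int[normal_prob m s]_x f x = \int[mu]_x (f x * (normal_pdf m s x)%:E))%E.
Proof.
move=> mf f0.
have dom := normal_prob_dominates m s.
rewrite -(Radon_Nikodym_SigmaFinite.change_of_variables dom)//.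
have mg : measurable_fun setT
    (Radon_Nikodym_SigmaFinite.f (normal_prob m s) mu).
  exact: (measurable_int mu (Radon_Nikodym_SigmaFinite.f_integrable dom)).
apply: ae_eq_integral => //.
- exact: emeasurable_funM.
- apply: emeasurable_funM => //; apply/measurable_EFinP.
  exact: measurable_normal_pdf.
- apply: ae_eqe_mul2l; apply: integral_ae_eq => //.
  + exact: Radon_Nikodym_SigmaFinite.f_integrable.
  + by apply/measurable_EFinP; exact: measurable_normal_pdf.
  + by move=> A _ mA; rewrite -Radon_Nikodym_SigmaFinite.f_integral.
Qed.

Section normal_variable.
Context {d : measure_display} {T : measurableType d} (P : probability T R).
Variables (X : T -> R) (s : R).
Hypothesis mX : measurable_fun setT X.
Hypothesis X_law : forall A, measurable A -> P (X @^-1` A) = normal_prob 0 s A.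
Hypothesis s_neq0 : s != 0.

Lemma ge0_integral_normal_variable (f : R -> R) :
  measurable_fun setT f -> (forall x, 0 <= f x) ->
  (\int[P]_w (f (X w))%:E = \int[mu]_x (f x * normal_pdf 0 s x)%:E)%E.
Proof.
move=> mf f0.
have mEf : measurable_fun setT (EFin \o f) by apply/measurable_EFinP.
under [RHS]eq_integral do rewrite EFinM.
rewrite -ge0_integral_normal_prob//.
have mX' : measurable_fun setT (X : T -> measurableTypeR R) by exact: mX.
pose mXm := isMeasurableFun.Build _ _ _ (measurableTypeR R) _ mX'.
pose X' : {mfun T >-> measurableTypeR R} :=
  HB.pack (X : T -> measurableTypeR R) mXm.
rewrite -(ge0_integral_distribution X' (f := EFin \o f))//.
apply: eq_measure_integral => A mA _; exact: (X_law mA).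
Qed.

(** Completing the square: exp (l x) times the density of N(0, s^2) is exp (l^2 s^2 / 2) times the
    density of N(l s^2, s^2), whose integral is 1. *)
Lemma normal_mgf (l : R) :
  (\int[P]_w (expR (l * X w))%:E = (expR (l ^+ 2 * s ^+ 2 / 2))%:E)%E.
Proof.
rewrite (@ge0_integral_normal_variable (fun x => expR (l * x))); last 2 first.
- by apply: measurableT_comp => //; exact: mulrl_measurable.
- by move=> x; exact: expR_ge0.
rewrite -[RHS]mule1 -(integral_normal_pdf (l * s ^+ 2) s).
rewrite -(integralZl measurableT (integrable_normal_pdf (l * s ^+ 2) s)).
apply: eq_integral => x _; rewrite -!EFinM !normal_pdfE//; congr EFin.
rewrite mulrCA [RHS]mulrCA; congr (_ * _).
rewrite /normal_fun -!expRD; congr expR.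
by field.
Qed.

(* With [1 + c X^2 <= exp (c X^2)], this bounds the second moment by a quantity
   that tends to [s^2] as [u] tends to [1]. *)
Lemma normal_expR_sq (u : R) : 0 < u -> u < 1 ->
  (\int[P]_w (expR ((1 - u ^+ 2) / (2 * s ^+ 2) * X w ^+ 2))%:E = (u^-1)%:E)%E.
Proof.
move=> u0 u1.
rewrite (@ge0_integral_normal_variable
  (fun x => expR ((1 - u ^+ 2) / (2 * s ^+ 2) * x ^+ 2))); last 2 first.
- apply: measurableT_comp => //; apply: (measurable_funM (measurable_cst _)).
  exact: exprn_measurable.
- by move=> x; exact: expR_ge0.
(* The factor turns the exponent - x^2 / (2 s^2) into - u^2 x^2 / (2 s^2), that of a normal law of
   deviation s / u; the ratio of the two peaks produces u^-1. *)
have su0 : s / u != 0 by rewrite mulf_neq0// invr_neq0// gt_eqF.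
rewrite -[RHS]mule1 -(integral_normal_pdf 0 (s / u)).
rewrite -(integralZl measurableT (integrable_normal_pdf 0 (s / u))).
apply: eq_integral => x _; rewrite -!EFinM !normal_pdfE//; congr EFin.
have -> : normal_peak (s / u) = u * normal_peak s.
  rewrite /normal_peak expr_div_n.
  have -> : s ^+ 2 / u ^+ 2 * pi *+ 2 = (u^-1) ^+ 2 * (s ^+ 2 * pi *+ 2).
    by move: (@pi R) => p; rewrite exprVn [in RHS]mulrnAr mulrA [_^-1 * _]mulrC.
  rewrite sqrtrM ?sqr_ge0// sqrtr_sqr ger0_norm ?invr_ge0 ?ltW//.
  by rewrite invfM invrK.
have -> : normal_fun 0 (s / u) x =
    expR ((1 - u ^+ 2) / (2 * s ^+ 2) * x ^+ 2) * normal_fun 0 s x.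
  rewrite /normal_fun -expRD; congr expR.
  by field; rewrite s_neq0 gt_eqF.
by rewrite -!mulrA mulKf ?gt_eqF// mulrCA.
Qed.

Lemma normal_second_moment : (\int[P]_w (X w ^+ 2)%:E <= (s ^+ 2)%:E)%E.
Proof.
set I := (\int[_]_w _)%E.
have mX2 : measurable_fun setT (fun w => X w ^+ 2) by exact: measurable_funX.
have I0 : (0 <= I)%E by apply: integral_ge0 => w _; rewrite lee_fin sqr_ge0.
(* With c = (1 - u^2) / (2 s^2), integrating 1 + c X^2 <= exp (c X^2) gives 1 + c I <= u^-1, and
   (u^-1 - 1) / c simplifies to this bound. *)
have ub u : 0 < u -> u < 1 -> (I <= (2 * s ^+ 2 / (u * (1 + u)))%:E)%E.
  move=> u0 u1.
  have c0 : 0 < (1 - u ^+ 2) / (2 * s ^+ 2).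
    apply: divr_gt0; last by rewrite mulr_gt0// exprn_even_gt0.
    by rewrite subr_gt0 expr_lt1// ltW.
  have := normal_expR_sq u0 u1.
  set c := (1 - u ^+ 2) / (2 * s ^+ 2) in c0 * => Ec.
  have : (c%:E * I + 1 <= (u^-1)%:E)%E.
    rewrite -Ec -(probability_setT P) -ge0_integralZl//; last 3 first.
    - exact/measurable_EFinP.
    - by move=> x _; rewrite lee_fin sqr_ge0.
    - by rewrite lee_fin ltW.
    rewrite -[P setT]mul1e -(integral_cst _ measurableT 1%E) -ge0_integralD//.
    - apply: ge0_le_integral => //.
      + by move=> w _; rewrite adde_ge0// -EFinM lee_fin mulr_ge0 ?sqr_ge0 ?ltW.
      + by apply: emeasurable_funD => //; apply: emeasurable_funM => //;
          exact/measurable_EFinP.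
      + apply/measurable_EFinP; apply: measurableT_comp => //.
        exact: measurable_funM.
      + by move=> w _; rewrite -EFinM -EFinD lee_fin addrC expR_ge1Dx.
    - by move=> w _; rewrite -EFinM lee_fin mulr_ge0 ?sqr_ge0 ?ltW.
    - by apply: emeasurable_funM => //; exact/measurable_EFinP.
  move: I0; case: I => [r||]//; last by rewrite gt0_muley ?lte_fin.
  rewrite -EFinM -EFinD !lee_fin => r0 h.
  have -> : 2 * s ^+ 2 / (u * (1 + u)) = (u^-1 - 1) / c.
    have u1p : 1 + u != 0 by rewrite gt_eqF// addr_gt0.
    have u1n : 1 - u != 0 by rewrite subr_eq0 gt_eqF.
    rewrite /c (_ : 1 - u ^+ 2 = (1 - u) * (1 + u)); last by ring.
    by field; rewrite u1p u1n s_neq0 gt_eqF.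
  by rewrite ler_pdivlMr// mulrC lerBrDr.
have : (2 * s ^+ 2 / (u * (1 + u)))%:E @[u --> 1^'-] --> (s ^+ 2)%:E.
  apply/cvg_EFin; first exact: nearW.
  apply: cvg_at_left_filter.
  have {2}-> : s ^+ 2 = 2 * s ^+ 2 / (1 * (1 + 1)) by field.
  apply: cvgM; first exact: cvg_cst.
  apply: cvgV; first by rewrite mul1r.
  by apply: cvgM; [exact: cvg_id|apply: cvgD; [exact: cvg_cst|exact: cvg_id]].
apply: cvge_ge.
near=> u; apply: ub; near: u.
  by apply: nbhs_left_gt.
exact: nbhs_left_lt.
Unshelve. all: by end_near. Qed.

Lemma normal_integrable_sq : P.-integrable setT (EFin \o (fun w => X w ^+ 2)).
Proof.
apply: integ_ge0; first exact: measurable_funX.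
  by move=> w; exact: sqr_ge0.
exact: le_lt_trans normal_second_moment (ltry _).
Qed.

Lemma normal_integrable : P.-integrable setT (EFin \o X).
Proof.
apply: (integ_le mX _ (integD (integ_cst P 1) normal_integrable_sq)) => w.
by rewrite ler_norml; apply/andP; split; nra.
Qed.

(** Integrating 1 + l X <= exp (l X) bounds l E X by exp (l^2 s^2 / 2) - 1, which is of order l^2.
    Taking both signs of l, dividing by |l| and letting l tend to 0 leaves no room for a nonzero
    mean. *)
Lemma normal_mean : \int[P]_w X w = 0.
Proof.
have iX := normal_integrable.
have ub l : l * \int[P]_w X w <= expR (l ^+ 2 * s ^+ 2 / 2) - 1.
  rewrite -RintegralZl// lerBrDr.
  have -> : expR (l ^+ 2 * s ^+ 2 / 2) = \int[P]_w expR (l * X w).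
    by rewrite /Rintegral normal_mgf.
  have ilX := integZ l iX.
  have -> : \int[P]_w (l * X w) + 1 = \int[P]_w (l * X w + 1).
    rewrite RintegralD//; last exact: integ_cst.
    by rewrite Rintegral_prob_cst.
  apply: le_Rintegral => //.
  - exact: integD ilX (integ_cst P 1).
  - apply: integ_ge0 => [|w|]; last by rewrite normal_mgf ltry.
      by apply: measurableT_comp => //; exact: measurable_funM.
    exact: expR_ge0.
  - by move=> w _; rewrite addrC expR_ge1Dx.
have small l : 0 < l -> l * s ^+ 2 < 1 -> l < 1 ->
    `|\int[P]_w X w| <= l * s ^+ 2.
  move=> l0 ls l1.
  (* For 0 <= y <= 1/2 one has exp y - 1 <= 2 y, because (1 - y) exp y <= 1 and (1 - y) (1 + 2 y) >=
     1. *)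
  have y1 : expR (l ^+ 2 * s ^+ 2 / 2) - 1 <= l ^+ 2 * s ^+ 2.
    set y := l ^+ 2 * s ^+ 2 / 2.
    have y0 : 0 <= y by rewrite /y; nra.
    have yh : y <= 2^-1.
      by rewrite /y ler_pdivrMr// mulVf// expr2 -mulrA; nra.
    have -> : l ^+ 2 * s ^+ 2 = 2 * y by rewrite /y; field.
    have e0 := expR_gt0 y.
    have h : (1 - y) * expR y <= 1.
      by rewrite -ler_pdivlMr// div1r -expRN expR_ge1Dx.
    nra.
  rewrite ler_norml; apply/andP; split.
    have := ub (- l); rewrite sqrrN mulNr => /le_trans/(_ y1) h; nra.
  have := ub l => /le_trans/(_ y1) h; nra.
apply/eqP; rewrite -normr_le0.
have : l * s ^+ 2 @[l --> 0^'+] --> (0 : R).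
  apply: cvg_at_right_filter; rewrite -{2}[0](mul0r (s ^+ 2)).
  by apply: cvgM; [exact: cvg_id|exact: cvg_cst].
move=> cv; apply: (cvgr_to_ge cv).
have s2 : 0 < s ^+ 2 by rewrite exprn_even_gt0.
near=> l; apply: small.
- by near: l; exact: nbhs_right_gt.
- rewrite -ltr_pdivlMr//; near: l; apply: nbhs_right_lt.
  by rewrite divr_gt0.
- by near: l; exact: nbhs_right_lt.
Unshelve. all: by end_near. Qed.

End normal_variable.

End normal_law.

(** * Independent real random variables *)

Section independence.
Context {d : measure_display} {T : measurableType d} {R : realType}.
Variable P : probability T R.
Local Notation integ f := (P.-integrable setT (EFin \o f)).

Definition independent_RV (U V : T -> R) := forall A B : set R,
  measurable A -> measurable B ->
  P (U @^-1` A `&` V @^-1` B) = (P (U @^-1` A) * P (V @^-1` B))%E.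

Section product.
Variables U V : T -> R.
Hypotheses (iU : integ U) (iV : integ V) (UV : independent_RV U V).

Let mU := measurable_integ iU.
Let mV := measurable_integ iV.
Let U' : {RV P >-> R} := mfun_Sub (mem_set mU).
Let V' : {RV P >-> R} := mfun_Sub (mem_set mV).
Let mUV : measurable_fun setT (fun w => (U w, V w)).
Proof. exact: measurable_fun_pair. Qed.
Let W' : {RV P >-> (R * R)%type} := mfun_Sub (mem_set mUV).

(** Independence is agreement on rectangles, which determines the product measure. The expectation
    of U V thus becomes a double integral, to which Fubini applies. *)
Let joint (X : set (R * R)) : measurable X ->
  (distribution P U' \x distribution P V')%E X = distribution P W' X.
Proof. by apply: product_measure_unique => A B mA mB; exact: UV. Qed.

Let f (z : R * R) : \bar R := (z.1 * z.2)%:E.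

Let mf : measurable_fun setT f.
Proof.
apply/measurable_EFinP; apply: measurable_funM; [exact: measurable_fst|].
exact: measurable_snd.
Qed.

Let iidU : (distribution P U').-integrable setT (fun x => x%:E).
Proof.
apply: (@integrable_pushforward _ _ _ _ _ U mU P setT (fun x => x%:E)) => //.
exact/measurable_EFinP/measurable_id.
Qed.

Let iidV : (distribution P V').-integrable setT (fun x => x%:E).
Proof.
apply: (@integrable_pushforward _ _ _ _ _ V mV P setT (fun x => x%:E)) => //.
exact/measurable_EFinP/measurable_id.
Qed.

(** By Tonelli the double integral of |x y| is E |U| times E |V|, and both are finite. *)
Let integrable_f :
  (distribution P U' \x distribution P V')%E.-integrable setT f.
Proof.
apply/integrable12ltyP => //.
have iV1 : (\int[distribution P V']_y `|y%:E| < +oo)%E.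
  by move: iidV => /integrableP[].
have [_ iU1] := (integrableP _ _ _ iidU).
under eq_integral.
  move=> x _; under eq_integral do rewrite /f/= normrM EFinM.
  rewrite integralZl//; last first.
    exact: (integrable_abse iidV).
  over.
have fV : (\int[distribution P V']_y `|y|%:E \is a fin_num)%E.
  by rewrite ge0_fin_numE// integral_ge0// => x _; rewrite lee_fin.
rewrite /= -(fineK fV).
rewrite integralZr//; last exact: (integrable_abse iidU).
rewrite lte_mul_pinfty// ?fineK//.
- by apply: integral_ge0 => x _; rewrite lee_fin.
- by rewrite ge0_fin_numE// integral_ge0// => x _; rewrite lee_fin.
Qed.

Lemma integM_independent : integ (fun w => U w * V w).
Proof.
apply/integrableP; split; first exact/measurable_EFinP/measurable_funM.
have /integrableP[_] := integrable_f.
rewrite (eq_measure_integral (distribution P W')); last first.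
  by move=> A mA _; exact: joint.
rewrite ge0_integral_distribution//.
exact: measurableT_comp.
Qed.

Lemma RintegralM_independent :
  \int[P]_w (U w * V w) = (\int[P]_w U w) * (\int[P]_w V w).
Proof.
have : (\int[P]_w (U w * V w)%:E =
    \int[distribution P U' \x distribution P V']_z f z)%E.
  rewrite (eq_measure_integral (distribution P W')); last first.
    by move=> A mA _; exact: joint.
  by rewrite integral_distribution//; exact: integM_independent.
rewrite /Rintegral => ->.
rewrite -integral12_prod_meas1// /fubini_F.
have fV : (\int[distribution P V']_y y%:E \is a fin_num)%E.
  exact: integrable_fin_num.
transitivity (fine (\int[distribution P U']_x
    (x%:E * \int[distribution P V']_y y%:E))%E).
  congr fine; apply: eq_integral => x _.
  by rewrite -integralZl//; apply: eq_integral => y _; rewrite /f EFinM.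
rewrite /= -(fineK fV) integralZr//.
rewrite fineM//; last exact: integrable_fin_num.
congr (fine _ * _) => /=.
  by rewrite (integral_distribution (X := U')).
by congr fine; rewrite (integral_distribution (X := V')).
Qed.

End product.
End independence.

(** * Borel sets of matrices *)

Section borel_matrix.
Context {R : realType} (p q : nat).
Local Notation E := (borel 'M[R]_(p, q)).

Lemma measurable_coord (i : 'I_p) (j : 'I_q) :
  measurable_fun [set: E] ((fun x : 'M[R]_(p, q) => x i j) : E -> R).
Proof.
apply: (measurability _ (RGenOInfty.measurableE R)).
move=> _ [_ [r ->] <-]; rewrite setTI; apply: sub_sigma_algebra.
apply: (@open_comp 'M[R]_(p, q) R); last exact: rray_open.
by move=> x _; exact: coord_continuous.
Qed.

Context {dT : measure_display} {T : measurableType dT}.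

(** The bridge from real-valued measurability, entry by entry, to the Borel sigma-algebra in which
    laws and coefficients are expressed. *)
Lemma measurable_matrix (f : T -> 'M[R]_(p, q)) :
  (forall i j, measurable_fun setT (fun w => f w i j)) ->
  measurable_fun setT (f : T -> E).
Proof.
move=> mf; apply: (@measurability _ _ _ E _ _ (@open 'M[R]_(p, q))) => //.
move=> _ [U oU <-]; rewrite setTI.
(* An open set is a countable union of rational boxes. *)
pose box (c : 'M[rat]_(p, q)) (n : nat) :=
  [set x : 'M[R]_(p, q) | forall i j, `|x i j - ratr (c i j)| < n.+1%:R^-1].
have -> : f @^-1` U = \bigcup_(cn : 'M[rat]_(p, q) * nat)
    (if `[< box cn.1 cn.2 `<=` U >] then f @^-1` box cn.1 cn.2 else set0).
  apply/seteqP; split => [w /= Uw|w [[c n] _]]; last first.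
    by case: asboolP => //= + h; apply.
  have /nbhs_ballP[e /= e0 eU] : nbhs (f w) U by exact: open_nbhs_nbhs.
  (* Two points of a box of half-width 1 / (n + 1) have entries less than 2 / (n + 1) apart, so a
     box containing [f w] lies in the ball of radius e. *)
  have [n n2] : exists n : nat, 2 * n.+1%:R^-1 < e.
    have [n hn] := ltr_add_invr (divr_gt0 e0 (ltr0n R 2)).
    by exists n; rewrite mulrC -ltr_pdivlMr// -[ltLHS]add0r.
  have n0 : (0 : R) < n.+1%:R^-1 by rewrite invr_gt0.
  have rat_near (x : R) : exists r : rat, `|x - ratr r| < n.+1%:R^-1.
    have [|r] := @rat_in_itvoo R (x - n.+1%:R^-1) (x + n.+1%:R^-1).
      by rewrite ltrD2l gtrN.
    rewrite in_itv/= => /andP[h1 h2]; exists r.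
    by rewrite ltr_distlC h1 h2.
  pose c : 'M[rat]_(p, q) := \matrix_(i, j) xchoose (rat_near (f w i j)).
  have fc : box c n (f w).
    by move=> i j; rewrite mxE; exact: (xchooseP (rat_near (f w i j))).
  exists (c, n) => //=; case: asboolP => //= -[] x xc; apply: eU.
  split=> // i j; rewrite /ball/=.
  have -> : f w i j - x i j = (f w i j - ratr (c i j)) - (x i j - ratr (c i j)).
    by ring.
  apply: le_lt_trans (ler_normB _ _) _.
  by apply: lt_trans n2; rewrite mulr_natl mulr2n ltrD.
apply: countable_bigcupT_measurable => // -[c n].
case: asboolP => // _ /=.
rewrite (_ : _ @^-1` _ = \bigcap_(ij in [set: 'I_p * 'I_q])
   ((fun w => f w ij.1 ij.2) @^-1`
      [set r | `|r - ratr (c ij.1 ij.2)| < n.+1%:R^-1])); last first.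
  apply/seteqP; split => w /= h => [[i j] _|i j] /=; first exact: h.
  exact: (h (i, j)).
apply: fin_bigcap_measurable => // -[i j] _.
rewrite -[X in measurable X]setTI; apply: mf => //=.
rewrite (_ : mkset _ = ball (ratr (c i j) : R) n.+1%:R^-1).
  exact: measurable_ball.
by apply/seteqP; split => r /=; rewrite /ball/= distrC.
Qed.

End borel_matrix.

(** * Empirical measures *)

Section euclidean_norm.
Context {R : realType}.

Lemma enormE n (x : 'cV[R]_n) : enorm x ^+ 2 = \sum_i x i 0 ^+ 2.
Proof. by rewrite /enorm sqr_sqrtr// sumr_ge0// => i _; rewrite sqr_ge0. Qed.

Lemma frobeniusE n p (A : 'M[R]_(n, p)) :
  frobenius A ^+ 2 = \sum_i \sum_j A i j ^+ 2.
Proof.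
rewrite /frobenius sqr_sqrtr// sumr_ge0// => i _; rewrite sumr_ge0// => j _.
exact: sqr_ge0.
Qed.

End euclidean_norm.

Section empirical_measures.
Context {R : realType} (d N : nat) (hN : (1 <= N)%N).
Local Notation E := (borel 'cV[R]_d).

Lemma integral_empirical n (y : 'I_N -> 'cV[R]_n)
    (f : borel 'cV[R]_n -> \bar R) :
  measurable_fun setT f -> (forall x, 0 <= f x)%E ->
  (\int[empirical_P2 hN y]_x f x = (N%:R^-1)%:E * \sum_(i < N) f (y i))%E.
Proof.
move=> mf f0.
(* [msum] takes a family indexed by [nat]; beyond N, [insubd] repeats the atom of index 0, which
   [msum D N] never reads. *)
pose D (k : nat) : {measure set (borel 'cV[R]_n) -> \bar R} :=
  \d_(y (insubd (Ordinal hN) k) : borel 'cV[R]_n).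
have N0 : (0 : R) <= N%:R^-1 by [].
pose c : {nonneg R} := NngNum N0.
rewrite (eq_measure_integral (mscale c (msum D N))); last first.
  move=> A _ _; rewrite /= /empirical /mscale /msum /=; congr (_ * _)%E.
  by apply: eq_bigr => i _; rewrite /D valKd.
rewrite ge0_integral_mscale// ge0_integral_measure_sum//; congr (_ * _)%E.
by apply: eq_bigr => i _; rewrite integral_dirac// diracT mul1e /= valKd.
Qed.

Lemma moment2_empirical (y : 'I_N -> 'cV[R]_d) :
  moment2 (empirical_P2 hN y) ^+ 2 = N%:R^-1 * \sum_i enorm (y i) ^+ 2.
Proof.
rewrite /moment2 sqr_sqrtr; last first.
  by apply: fine_ge0; apply: integral_ge0 => x _; rewrite lee_fin sqr_ge0.
rewrite /= integral_empirical; last 2 first.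
- exact: measurable_enorm2.
- by move=> x; rewrite lee_fin sqr_ge0.
by rewrite sumEFin -EFinM.
Qed.

(* The coupling which moves the i-th atom of one measure to the i-th atom of
   the other. *)
Lemma W2_empirical_le (y z : 'I_N -> 'cV[R]_d) :
  W2 (empirical_P2 hN y) (empirical_P2 hN z) ^+ 2 <=
  N%:R^-1 * \sum_i enorm (y i - z i) ^+ 2.
Proof.
(* The law of (y_i, z_i) for a uniform index i is the image, under unstacking, of the empirical
   measure of the vectors [col_mx (y i) (z i)]. *)
pose g (x : borel 'cV[R]_(d + d)) : (E * E)%type := (usubmx x, dsubmx x).
have mg : measurable_fun setT g.
  apply: measurable_fun_pair; apply: measurable_matrix => i j /=.
    rewrite (_ : (fun _ => _) = fun x : 'cV[R]_(d + d) => x (lshift d i) j).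
      exact: measurable_coord.
    by apply/funext => x; rewrite mxE.
  rewrite (_ : (fun _ => _) = fun x : 'cV[R]_(d + d) => x (rshift d i) j).
    exact: measurable_coord.
  by apply/funext => x; rewrite mxE.
pose u (i : 'I_N) := col_mx (y i) (z i).
pose gm := isMeasurableFun.Build _ _ _ _ _ mg.
pose G : {mfun (borel 'cV[R]_(d + d)) >-> (E * E)%type} := HB.pack g gm.
pose pi : probability (E * E)%type R := distribution (empirical_P2 hN u) G.
have cpl : coupling (empirical_P2 hN y) (empirical_P2 hN z) pi.
  move=> A mA; split; rewrite /= /pi /distribution /pushforward /= /empirical;
    congr (_ * _)%E; apply: eq_bigr => i _; rewrite !diracE; congr (_%:R%:E);
    congr nat_of_bool; apply/idP/idP;
    by rewrite !inE /= /g /setX /= ?col_mxKu ?col_mxKd; tauto.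
pose c (t : E * E) : \bar R := (enorm ((t.1 : 'cV[R]_d) - t.2) ^+ 2)%:E.
have mc : measurable_fun setT c.
  apply/measurable_EFinP.
  rewrite (_ : (fun _ => _) =
    fun t : E * E => \sum_i ((t.1 : 'cV[R]_d) i 0 - (t.2 : 'cV[R]_d) i 0) ^+ 2).
    apply: measurable_sum => i; apply: measurable_funX; apply: measurable_funB.
      exact: (measurableT_comp (measurable_coord i 0) measurable_fst).
    exact: (measurableT_comp (measurable_coord i 0) measurable_snd).
  by apply/funext => t; rewrite enormE; apply: eq_bigr => i _; rewrite !mxE.
have c0 t : (0 <= c t)%E by rewrite lee_fin sqr_ge0.
have cost : (\int[pi]_t c t = (N%:R^-1 * \sum_i enorm (y i - z i) ^+ 2)%:E)%E.
  rewrite ge0_integral_distribution//.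
  rewrite integral_empirical; last 2 first.
  - exact: (measurableT_comp mc mg).
  - by move=> x; exact: c0.
  rewrite EFinM -sumEFin; congr (_ * _)%E; apply: eq_bigr => i _.
  by rewrite /c /= /g col_mxKu col_mxKd.
rewrite /W2; set S := [set _ | _ in _].
have S0 : (0 <= ereal_inf S)%E.
  apply: le_ereal_inf_tmp => _ [p _ <-]; apply: integral_ge0 => t _; exact: c0.
have Sc : (ereal_inf S <= (N%:R^-1 * \sum_i enorm (y i - z i) ^+ 2)%:E)%E.
  by apply: ereal_inf_lbound; exists pi.
rewrite sqr_sqrtr ?fine_ge0// -lee_fin fineK// ge0_fin_numE//.
exact: le_lt_trans Sc (ltry _).
Qed.

Context {dT : measure_display} {T : measurableType dT}.

(** It suffices that [Phi] pulls every set of [open_cV_P2] back to a measurable set. The space [T]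
    is kept general because the lemma is applied to [Omega] with the sigma-algebra of the history,
    which makes the coefficients adapted. *)
Lemma measurable_coef p q (f : 'cV[R]_d -> P2 R d -> 'M[R]_(p, q))
    (Y : T -> 'I_N -> 'cV[R]_d) (j : 'I_N) : borel_coef f ->
  (forall i r, measurable_fun setT (fun w => Y w i r 0)) ->
  measurable_fun setT
    ((fun w => f (Y w j) (empirical_P2 hN (Y w))) : T -> borel 'M[R]_(p, q)).
Proof.
move=> mf mY.
pose Phi w := (Y w j, empirical_P2 hN (Y w)).
suff mPhi : <<s @open_cV_P2 R d >> `<=` [set S | measurable (Phi @^-1` S)].
  by move=> _ A mA; rewrite setTI; exact: (mPhi _ (mf _ mA)).
apply: smallest_sub.
  have := @sigma_algebra_image T _ setT Phi measurable
    (sigma_algebra_measurable T).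
  rewrite /image_set_system.
  by under eq_set do rewrite setTI.
(* [W2_empirical_le] makes [Psi] below continuous. *)
move=> U oU /=.
pose Z w : 'M[R]_(d, N) := \matrix_(r, i) Y w i r 0.
pose Psi (z : 'M[R]_(d, N)) := (col j z, empirical_P2 hN (fun i => col i z)).
have PhiE w : Phi w = Psi (Z w).
  rewrite /Phi /Psi.
  have YZ i : col i (Z w) = Y w i.
    by apply/matrixP => r k; rewrite !mxE ord1.
  by rewrite YZ; congr (_, empirical_P2 hN _); apply/funext => i; rewrite YZ.
have -> : Phi @^-1` U = Z @^-1` (Psi @^-1` U).
  by apply/seteqP; split => w /=; rewrite PhiE.
have mZ : measurable_fun setT (Z : T -> borel 'M[R]_(d, N)).
  apply: measurable_matrix => r i.
  by under eq_fun do rewrite mxE; exact: mY.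
rewrite -[X in measurable X]setTI; apply: mZ => //.
apply: sub_sigma_algebra.
rewrite openE => z Uz; rewrite /interior.
have [e e0 eU] := oU _ Uz.
(* If entries differ by less than [dl], columns differ by at most sqrt d times [dl] in Euclidean
   norm; dividing by d + 1 makes this smaller than e, also for d = 0. *)
pose dl := e / (d%:R + 1).
have d0 : (0 : R) < d%:R + 1 by rewrite ltr_wpDl.
have dl0 : 0 < dl by rewrite divr_gt0.
apply/nbhs_ballP; exists dl => //= z' [_ zz'].
have lt_e (x : R) : x ^+ 2 <= d%:R * dl ^+ 2 -> x < e.
  move=> hx; have h : d%:R * dl ^+ 2 < e ^+ 2.
    rewrite /dl expr_div_n mulrCA gtr_pMr ?exprn_gt0// ltr_pdivrMr ?exprn_gt0//.
    have : (0 : R) <= d%:R by [].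
    by nra.
  have [x0|x0] := ltP x 0; first exact: lt_trans x0 e0.
  by rewrite -(@ltr_pXn2r _ 2)// ?nnegrE ?(ltW e0)//; exact: le_lt_trans hx h.
have col_le i : enorm (col i z - col i z') ^+ 2 <= d%:R * dl ^+ 2.
  rewrite enormE; apply: (@le_trans _ _ (\sum_(r < d) dl ^+ 2)).
    apply: ler_sum => r _; rewrite !mxE -real_normK ?num_real//.
    rewrite lerXn2r ?nnegrE ?(ltW dl0)//; apply/ltW; exact: zz'.
  by rewrite sumr_const card_ord mulr_natl.
apply: eU => /=; apply: lt_e; first exact: col_le.
apply: le_trans (W2_empirical_le _ _) _.
rewrite ler_pdivrMl ?ltr0n//.
apply: (@le_trans _ _ (\sum_(i < N) d%:R * dl ^+ 2)).
  by apply: ler_sum => i _; exact: col_le.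
by rewrite sumr_const card_ord -[leLHS]mulr_natl.
Qed.

End empirical_measures.

(** * Independence of the increments from the past of all particles *)

(** As functions of B, the two sides are finite measures that agree on a pi-system containing the
    whole space, hence on the sigma-algebra it generates. *)
Lemma independent_g_sigma {d : measure_display} {T : measurableType d}
    {R : realType} (P : probability T R) (G : set (set T)) (D : set T) :
  G `<=` measurable -> setI_closed G -> G setT -> measurable D ->
  (forall B, G B -> P (B `&` D) = (P B * P D)%E) ->
  forall B, <<s G >> B -> P (B `&` D) = (P B * P D)%E.
Proof.
move=> mG GI GT mD GD B sB.
have fD : (P D \is a fin_num)%E by exact: fin_num_measure.
have pD : 0 <= fine (P D) by exact: fine_ge0.
rewrite muleC -(fineK fD).
apply: (g_sigma_algebra_measure_unique G mG (fun=> setT) _ _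
  (mrestr P mD) (mscale (NngNum pD) P)) => //.
- by rewrite bigcup_const//; exists 0%N.
- move=> A GA; have := GD _ GA.
  by rewrite muleC -[in X in _ = X -> _](fineK fD).
- move=> _; have : (P (setT `&` D) < +oo)%E by rewrite setTI ltey_eq fD.
  by [].
Qed.

Section driving_history.
Context {R : realType} (m d : nat).
Local Notation S := (driving_space R m d).

(** These sets live on the state space of one driving pair, not on [Omega], so that the same past
    event can be read on (W, X0) and on each copy. *)
Definition past_cylinders (s : R) : set (set S) :=
  [set C | exists t (A : set (borel 'cV[R]_m)),
     [/\ 0 <= t <= s, measurable A & C = [set z | A (z.1 t)]]] `|`
  [set C | exists2 A : set (borel 'cV[R]_d),
     measurable A & C = [set z | A z.2]].

Definition past (s : R) := <<s past_cylinders s >>.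

Lemma past_measurable s : past s `<=` measurable.
Proof.
apply: smallest_sub; first exact: sigma_algebra_measurable.
move=> C [[t [A [/andP[t0 _] mA ->]]]|[A mA ->]]; apply: sub_sigma_algebra.
  by left; exists t, A.
by right; exists A.
Qed.

Lemma past_mono s t : s <= t -> past s `<=` past t.
Proof.
move=> st; apply: sub_sigma_algebra2 => C [[u [A [/andP[u0 us] mA ->]]]|h].
  by left; exists u, A; rewrite u0 (le_trans us st).
by right.
Qed.

Lemma measurable_driving_incr (s t : R) (A : set (borel 'cV[R]_m)) :
  0 <= s -> 0 <= t -> measurable A ->
  measurable [set z : S | A (z.1 t - z.1 s)].
Proof.
move=> s0 t0 mA.
have ev u : 0 <= u ->
    measurable_fun setT ((fun z : S => z.1 u) : S -> borel 'cV[R]_m).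
  move=> u0 _ B mB; rewrite setTI; apply: sub_sigma_algebra.
  by left; exists u, B.
have mf : measurable_fun setT
    ((fun z : S => z.1 t - z.1 s) : S -> borel 'cV[R]_m).
  apply: measurable_matrix => i j.
  rewrite (_ : (fun _ => _) = fun z : S => z.1 t i j - z.1 s i j); last first.
    by apply/funext => z; rewrite !mxE.
  apply: measurable_funB.
    exact: (measurableT_comp (measurable_coord i j) (ev _ t0)).
  exact: (measurableT_comp (measurable_coord i j) (ev _ s0)).
by rewrite -[X in measurable X]setTI; exact: mf.
Qed.

End driving_history.

Section particles.
Context {R : realType} (d m N : nat) {dO : measure_display}
  {Omega : measurableType dO} (P : probability Omega R).
Variables (F : R -> set (set Omega)) (W : R -> Omega -> 'cV[R]_m)
  (X0 : Omega -> 'cV[R]_d).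
Variables (Ws : 'I_N -> R -> Omega -> 'cV[R]_m)
  (X0s : 'I_N -> Omega -> 'cV[R]_d).
Local Notation S := (driving_space R m d).
Local Notation Z := (fun j => driving (Ws j) (X0s j)).
Hypothesis hF : usual_conditions P F.
Hypothesis hW : brownian_motion P F W.
Hypothesis hX0 : measurable_wrt (F 0) (X0 : Omega -> borel 'cV[R]_d).
Hypothesis hcopies : iid_copies P (driving W X0) Z.

Lemma past_adapted s C : 0 <= s -> past s C -> F s (driving W X0 @^-1` C).
Proof.
move=> s0; have [_ /(_ _ s0)[sF _] Fmono _ _] := hF.
have [aW _ _ _ _] := hW.
have := @sigma_algebra_image _ _ setT (driving W X0) _ sF.
rewrite /image_set_system => sI.
suff : past s `<=` [set C | F s (setT `&` driving W X0 @^-1` C)].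
  by move=> h /h /=; rewrite setTI.
apply: smallest_sub => // {}C [[t [A [/andP[t0 ts] mA ->]]]|[A mA ->]] /=;
  rewrite setTI.
  by apply: (Fmono _ _ t0 ts); exact: (aW _ t0 _ mA).
exact: (Fmono _ _ (lexx 0) s0 _ (hX0 mA)).
Qed.

(** Product form, one past event per particle, gives a pi-system on which [iid_copies] factorises
    the probability. *)
Definition history_cylinders (s : R) : set (set Omega) :=
  [set B | exists2 A : 'I_N -> set S,
     forall i, past s (A i) & B = [set w | forall i, A i (Z i w)]].

Definition history (s : R) := <<s history_cylinders s >>.

Lemma measurable_particle i C : measurable C -> measurable (Z i @^-1` C).
Proof.
move=> mC; have [mZ _ _] := hcopies.
by rewrite -[X in measurable X]setTI; exact: mZ.
Qed.

Lemma history_cylinders_measurable s : history_cylinders s `<=` measurable.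
Proof.
move=> _ [A pA ->].
rewrite (_ : mkset _ = \bigcap_(i in [set: 'I_N]) (Z i @^-1` A i)); last first.
  by apply/seteqP; split => w /= h i => [_|]; exact: h.
apply: fin_bigcap_measurable => // i _; apply: measurable_particle.
exact: (past_measurable (pA i)).
Qed.

Lemma history_measurable s : history s `<=` measurable.
Proof.
apply: smallest_sub; first exact: sigma_algebra_measurable.
exact: history_cylinders_measurable.
Qed.

Lemma history_mono s t : s <= t -> history s `<=` history t.
Proof.
move=> st; apply: sub_sigma_algebra2 => _ [A pA ->].
by exists A => // i; exact: (past_mono st (pA i)).
Qed.

Lemma past_history s i C : past s C -> history s (Z i @^-1` C).
Proof.
move=> pC; apply: sub_sigma_algebra.
exists (fun k => if k == i then C else setT).
  move=> k; case: eqP => // _.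
  exact: (@measurableT _ (g_sigma_algebraType (past_cylinders s))).
apply/seteqP; split => w /= => [h k|/(_ i)]; last by rewrite eqxx.
by case: eqP => // ->.
Qed.

Section increment.
Variables (s t : R) (j : 'I_N).
Hypotheses (s0 : 0 <= s) (st : s < t).

Let t0 : 0 <= t. Proof. exact: le_trans s0 (ltW st). Qed.

Lemma increment_law (A : set (borel 'cV[R]_m)) : measurable A ->
  P [set w | A (Ws j t w - Ws j s w)] = P [set w | A (W t w - W s w)].
Proof.
move=> mA; have [_ /(_ j _ (measurable_driving_incr s0 t0 mA)) h _] := hcopies.
exact: h.
Qed.

(** On a product of past events, the increment event is absorbed into the j-th factor, since it too
    concerns the j-th driving pair alone. Independence of the copies isolates that factor, and the
    Brownian property of W splits it. [independent_g_sigma] extends the identity to the whole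
    history. *)
Lemma increment_history (A : set (borel 'cV[R]_m)) B : measurable A ->
  history s B ->
  P (B `&` [set w | A (Ws j t w - Ws j s w)]) =
  (P B * P [set w | A (Ws j t w - Ws j s w)%R])%E.
Proof.
move=> mA hB.
have mI := measurable_driving_incr (d := d) s0 t0 mA.
set I := [set z | _] in mI.
have [mZ lZ iZ] := hcopies; have [_ _ _ indW _] := hW.
apply: (independent_g_sigma (@history_cylinders_measurable s)) => //.
- move=> _ _ [A1 pA1 ->] [A2 pA2 ->]; exists (fun i => A1 i `&` A2 i).
    move=> i.
    exact: (@measurableI _ (g_sigma_algebraType (past_cylinders s))
      _ _ (pA1 i) (pA2 i)).
  by apply/seteqP; split => w /= => [[h1 h2] i|h];
    [|split => i; have [] := h i].
- exists (fun=> setT); last by apply/seteqP; split.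
  move=> i; exact: (@measurableT _ (g_sigma_algebraType (past_cylinders s))).
- exact: (measurable_particle j mI).
move=> _ [C pC ->].
have mC i : measurable (C i) by exact: (past_measurable (pC i)).
have -> : [set w | forall i, C i (Z i w)] `&`
      [set w | A (Ws j t w - Ws j s w)] =
    [set w | forall i, (if i == j then C i `&` I else C i) (Z i w)].
  apply/seteqP; split => w /= => [[h1 h2] i|h].
    by case: eqP => [->|_]; [split|]; rewrite //; exact: h1.
  split=> [i|]; first by have := h i; case: (i == j) => // -[].
  by have := h j; rewrite eqxx => -[].
rewrite (iZ (fun i => if i == j then C i `&` I else C i)); last first.
  by move=> i; case: (i == j); [exact: (measurableI _ _ (mC i) mI)|exact: mC].
rewrite (iZ C)//.
rewrite (bigD1 j)//= eqxx [in RHS](bigD1 j)//=.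
rewrite (eq_bigr (fun i => P (Z i @^-1` C i))); last first.
  by move=> i /negbTE ->.
(* The j-th factor passes to (W, X0), where [C j] becomes an event of F_s independent of the
   increment; the two resulting factors then return to the copy. *)
rewrite lZ; last exact: (measurableI _ _ (mC j) mI).
rewrite muleAC; congr (_ * _)%E.
rewrite (_ : _ @^-1` (C j `&` I) =
  (driving W X0 @^-1` C j) `&` [set w | A (W t w - W s w)]) //.
rewrite (indW s t s0 st _ A (past_adapted s0 (pC j)))//.
by rewrite lZ// -increment_law.
Qed.

End increment.
End particles.

(** * Moments of the Brownian increments *)

Section quadratic_form.
Context {R : realType} (n p : nat).
Implicit Types (v : 'cV[R]_n) (A : 'M[R]_(n, p)) (x : 'cV[R]_p).

(** The coefficients are the entries of 2 A^T v and of the Gram matrix A^T A: each summand separates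
    a function of the past from a monomial in the increment. *)
Lemma enorm_sq_affine v A x :
  enorm (v + A *m x) ^+ 2 = enorm v ^+ 2 +
    (\sum_i (2 * \sum_r v r 0 * A r i) * x i 0 +
     \sum_i \sum_l (\sum_r A r i * A r l) * (x i 0 * x l 0)).
Proof.
rewrite !enormE.
transitivity (\sum_r (v r 0 ^+ 2 + (\sum_i 2 * (v r 0 * A r i) * x i 0 +
    \sum_i \sum_l A r i * A r l * (x i 0 * x l 0)))).
  apply: eq_bigr => r _; rewrite !mxE sqrrD -addrA; congr (_ + (_ + _)).
    rewrite -mulr_natl mulr_sumr mulr_sumr.
    by apply: eq_bigr => i _; rewrite !mulrA.
  rewrite expr2 mulr_suml; apply: eq_bigr => i _; rewrite mulr_sumr.
  by apply: eq_bigr => l _; ring.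
rewrite !big_split/=; congr (_ + (_ + _)); rewrite exchange_big/=.
  by apply: eq_bigr => i _; rewrite mulr_sumr mulr_suml.
apply: eq_bigr => i _; rewrite exchange_big/=.
by apply: eq_bigr => l _; rewrite mulr_suml.
Qed.

Lemma col_sq_le_frobenius A i : \sum_r A r i ^+ 2 <= frobenius A ^+ 2.
Proof.
rewrite frobeniusE; apply: ler_sum => r _.
by rewrite (bigD1 i)//= lerDl sumr_ge0// => l _; rewrite sqr_ge0.
Qed.

(** By 2 |a b| <= a^2 + b^2. Together with [norm_gram_le], this makes the coefficients of the
    expansion integrable from second moments alone. *)
Lemma norm_dot_col_le v A i :
  `|2 * \sum_r v r 0 * A r i| <= enorm v ^+ 2 + frobenius A ^+ 2.
Proof.
apply: le_trans (lerD (lexx _) (col_sq_le_frobenius A i)).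
rewrite enormE -big_split/= mulr_sumr.
apply: le_trans (ler_norm_sum _ _ _) _; apply: ler_sum => r _.
by rewrite ler_norml; apply/andP; split;
  [have := sqr_ge0 (v r 0 + A r i)|have := sqr_ge0 (v r 0 - A r i)]; nra.
Qed.

Lemma norm_gram_le A i l :
  `|\sum_r A r i * A r l| <= frobenius A ^+ 2 + frobenius A ^+ 2.
Proof.
apply: le_trans (lerD (col_sq_le_frobenius A i) (col_sq_le_frobenius A l)).
rewrite -big_split/=.
apply: le_trans (ler_norm_sum _ _ _) _; apply: ler_sum => r _.
by rewrite ler_norml; apply/andP; split;
  [have := sqr_ge0 (A r i + A r l)|have := sqr_ge0 (A r i - A r l)];
  have := sqr_ge0 (A r i); have := sqr_ge0 (A r l); nra.
Qed.

End quadratic_form.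

Section increment_moments.
Context {R : realType} (d m N : nat) {dO : measure_display}
  {Omega : measurableType dO} (P : probability Omega R).
Variables (F : R -> set (set Omega)) (W : R -> Omega -> 'cV[R]_m)
  (X0 : Omega -> 'cV[R]_d).
Variables (Ws : 'I_N -> R -> Omega -> 'cV[R]_m)
  (X0s : 'I_N -> Omega -> 'cV[R]_d).
Local Notation Z := (fun j => driving (Ws j) (X0s j)).
Hypothesis hF : usual_conditions P F.
Hypothesis hW : brownian_motion P F W.
Hypothesis hX0 : measurable_wrt (F 0) (X0 : Omega -> borel 'cV[R]_d).
Hypothesis hcopies : iid_copies P (driving W X0) Z.
Variables (s t : R) (j : 'I_N).
Hypotheses (s0 : 0 <= s) (st : s < t).
Local Notation integ f := (P.-integrable setT (EFin \o f)).
Local Notation H := (g_sigma_algebraType (history_cylinders Ws X0s s)).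
Local Notation xi := (fun w => Ws j t w - Ws j s w).

Let t0 : 0 <= t. Proof. exact: le_trans s0 (ltW st). Qed.

Lemma history_measurable_fun (U : Omega -> R) :
  measurable_fun setT (U : H -> R) -> measurable_fun setT U.
Proof.
move=> mU _ A mA; apply: (history_measurable hcopies (s := s)).
exact: mU.
Qed.

Lemma measurable_increment :
  measurable_fun setT (xi : Omega -> borel 'cV[R]_m).
Proof.
move=> _ A mA; rewrite setTI.
exact: (measurable_particle hcopies j (measurable_driving_incr s0 t0 mA)).
Qed.

Lemma measurable_increment_coord i : measurable_fun setT (fun w => xi w i 0).
Proof.
exact: (measurableT_comp (measurable_coord i 0) measurable_increment).
Qed.

Lemma increment_coords (A : 'I_m -> set R) : (forall i, measurable (A i)) ->
  P [set w | forall i, A i (xi w i 0)] =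
  (\prod_i normal_prob 0 (Num.sqrt (t - s)) (A i))%E.
Proof.
move=> mA; have [_ _ _ _ lawW] := hW.
rewrite -(lawW s t s0 st A mA).
have mB : measurable ([set x : 'cV[R]_m | forall i, A i (x i 0)] :
    set (borel 'cV[R]_m)).
  rewrite (_ : mkset _ = \bigcap_(i in [set: 'I_m])
      ((fun x : borel 'cV[R]_m => (x : 'cV[R]_m) i 0) @^-1` A i)); last first.
    by apply/seteqP; split => x /= h i => [_|]; exact: h.
  apply: fin_bigcap_measurable => // i _.
  by rewrite -[X in measurable X]setTI; exact: (measurable_coord i 0).
exact: (increment_law hcopies j s0 st mB).
Qed.

Lemma increment_coord_law i (A : set R) : measurable A ->
  P ((fun w => xi w i 0) @^-1` A) = normal_prob 0 (Num.sqrt (t - s)) A.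
Proof.
move=> mA; pose B k := if k == i then A else setT.
have -> : (fun w => xi w i 0) @^-1` A = [set w | forall k, B k (xi w k 0)].
  apply/seteqP; split => w /= => [h k|/(_ i)]; last by rewrite /B eqxx.
  by rewrite /B; case: eqP => // ->.
rewrite increment_coords => [|k]; last by rewrite /B; case: (k == i).
rewrite (bigD1 i)//= /B eqxx big1 ?mule1// => k /negbTE ->.
exact: probability_setT.
Qed.

Lemma increment_coords_independent i l : i != l ->
  independent_RV P (fun w => xi w i 0) (fun w => xi w l 0).
Proof.
move=> il A1 A2 mA1 mA2.
rewrite !increment_coord_law//.
pose B k := if k == i then A1 else if k == l then A2 else setT.
have -> : (fun w => xi w i 0) @^-1` A1 `&` (fun w => xi w l 0) @^-1` A2 =
    [set w | forall k, B k (xi w k 0)].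
  apply/seteqP; split => w /= => [[h1 h2] k|h].
    by rewrite /B; case: eqP => [->//|_]; case: eqP => [->|].
  split; first by have := h i; rewrite /B eqxx.
  by have := h l; rewrite /B eqxx eq_sym (negbTE il).
rewrite increment_coords => [|k]; last first.
  by rewrite /B; case: (k == i) => //; case: (k == l).
rewrite (bigD1 i)//= (bigD1 l)//=; last by rewrite eq_sym.
rewrite /B !eqxx [l == i]eq_sym (negbTE il) big1 ?mule1//.
move=> k /andP[/negbTE -> /negbTE ->].
exact: probability_setT.
Qed.

Let sd_neq0 : Num.sqrt (t - s) != 0.
Proof. by rewrite gt_eqF// sqrtr_gt0 subr_gt0. Qed.

Lemma increment_independent (U : Omega -> R) (g : borel 'cV[R]_m -> R) :
  measurable_fun setT (U : H -> R) -> measurable_fun setT g ->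
  independent_RV P U (fun w => g (xi w)).
Proof.
move=> mU mg A B mA mB.
have mgB : measurable (g @^-1` B).
  by rewrite -[X in measurable X]setTI; exact: mg.
apply: (increment_history hF hW hX0 hcopies j s0 st mgB).
by have := mU measurableT _ mA; rewrite setTI.
Qed.

Lemma integ_history_increment (U : Omega -> R) i :
  measurable_fun setT (U : H -> R) -> integ U ->
  integ (fun w => U w * xi w i 0).
Proof.
move=> mU iU; apply: integM_independent => //.
  exact: (normal_integrable (measurable_increment_coord i)
    (@increment_coord_law i)).
exact: (increment_independent mU (measurable_coord i 0)).
Qed.

Lemma Rintegral_history_increment (U : Omega -> R) i :
  measurable_fun setT (U : H -> R) -> integ U ->
  \int[P]_w (U w * xi w i 0) = 0.
Proof.
move=> mU iU.
have mi := measurable_increment_coord i.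
have li := @increment_coord_law i.
rewrite RintegralM_independent//; first by rewrite (normal_mean mi li)// mulr0.
  exact: (normal_integrable mi li).
exact: (increment_independent mU (measurable_coord i 0)).
Qed.

Let integ_coord2 i l : integ (fun w => xi w i 0 * xi w l 0).
Proof.
have iX k := normal_integrable (measurable_increment_coord k)
  (@increment_coord_law k) sd_neq0.
have [->|il] := eqVneq i l.
  exact: (normal_integrable_sq (measurable_increment_coord l)
    (@increment_coord_law l)).
apply: integM_independent => //.
exact: increment_coords_independent.
Qed.

Let measurable_coord2 i l :
  measurable_fun [set: borel 'cV[R]_m]
    ((fun x : 'cV[R]_m => x i 0 * x l 0) : borel 'cV[R]_m -> R).
Proof. by apply: measurable_funM; exact: measurable_coord. Qed.

Lemma integ_history_increment2 (U : Omega -> R) i l :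
  measurable_fun setT (U : H -> R) -> integ U ->
  integ (fun w => U w * (xi w i 0 * xi w l 0)).
Proof.
move=> mU iU; apply: integM_independent => //.
exact: (increment_independent mU (measurable_coord2 i l)).
Qed.

Lemma Rintegral_history_increment2 (U : Omega -> R) i l : i != l ->
  measurable_fun setT (U : H -> R) -> integ U ->
  \int[P]_w (U w * (xi w i 0 * xi w l 0)) = 0.
Proof.
move=> il mU iU; rewrite RintegralM_independent//; last first.
  exact: (increment_independent mU (measurable_coord2 i l)).
have iX k := normal_integrable (measurable_increment_coord k)
  (@increment_coord_law k) sd_neq0.
rewrite (RintegralM_independent (iX i) (iX l)
  (increment_coords_independent il)).
by rewrite (normal_mean (measurable_increment_coord i)
  (@increment_coord_law i))// mul0r mulr0.
Qed.

(** Nonnegativity of [U] lets the one-sided bound on the variance of the increment suffice. *)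
Lemma Rintegral_history_increment_sq (U : Omega -> R) i :
  (forall w, 0 <= U w) ->
  measurable_fun setT (U : H -> R) -> integ U ->
  \int[P]_w (U w * (xi w i 0 * xi w i 0)) <= (t - s) * \int[P]_w U w.
Proof.
move=> U0 mU iU; rewrite RintegralM_independent//; last first.
  exact: (increment_independent mU (measurable_coord2 i i)).
rewrite mulrC ler_wpM2r ?Rintegral_ge0//.
have := normal_second_moment (measurable_increment_coord i)
  (@increment_coord_law i) sd_neq0.
rewrite sqr_sqrtr; last by rewrite subr_ge0 ltW.
move=> h; rewrite -lee_fin /Rintegral fineK//.
exact: integrable_fin_num (integ_coord2 i i).
Qed.

(** Term by term in the expansion: the linear terms and the off-diagonal quadratic ones have mean
    zero, and the diagonal ones each contribute at most t - s times a diagonal Gram entry. *)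
Lemma second_moment_step (v : Omega -> 'cV[R]_d) (A : Omega -> 'M[R]_(d, m)) :
  (forall r, measurable_fun setT ((fun w => v w r 0) : H -> R)) ->
  (forall r i, measurable_fun setT ((fun w => A w r i) : H -> R)) ->
  integ (fun w => enorm (v w) ^+ 2) -> integ (fun w => frobenius (A w) ^+ 2) ->
  integ (fun w => enorm (v w + A w *m xi w) ^+ 2) /\
  \int[P]_w (enorm (v w + A w *m xi w) ^+ 2) <=
  \int[P]_w (enorm (v w) ^+ 2) + (t - s) * \int[P]_w (frobenius (A w) ^+ 2).
Proof.
move=> mv mA iv iA.
pose c i w := 2 * \sum_r v w r 0 * A w r i.
pose S i l w := \sum_r A w r i * A w r l.
have expand w : enorm (v w + A w *m xi w) ^+ 2 =
    enorm (v w) ^+ 2 + (\sum_i c i w * xi w i 0 +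
      \sum_i \sum_l S i l w * (xi w i 0 * xi w l 0)).
  exact: enorm_sq_affine.
have mc i : measurable_fun setT (c i : H -> R).
  apply: measurable_funM => //; apply: measurable_sum => r.
  exact: measurable_funM.
have mS i l : measurable_fun setT (S i l : H -> R).
  by apply: measurable_sum => r; exact: measurable_funM.
have ic i : integ (c i).
  apply: integ_le (integD iv iA); first exact: history_measurable_fun.
  by move=> w; exact: norm_dot_col_le.
have iS i l : integ (S i l).
  apply: integ_le (integD iA iA); first exact: history_measurable_fun.
  by move=> w; exact: norm_gram_le.
have i1 : integ (fun w => \sum_i c i w * xi w i 0).
  by apply: integ_sum => i; exact: integ_history_increment.
have i2 i : integ (fun w => \sum_l S i l w * (xi w i 0 * xi w l 0)).
  by apply: integ_sum => l; exact: integ_history_increment2.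
have i3 : integ (fun w => \sum_i \sum_l S i l w * (xi w i 0 * xi w l 0)).
  exact: integ_sum.
have i4 := integD i1 i3.
rewrite (_ : (fun w => enorm (v w + A w *m xi w) ^+ 2) = fun w =>
  enorm (v w) ^+ 2 + (\sum_i c i w * xi w i 0 +
      \sum_i \sum_l S i l w * (xi w i 0 * xi w l 0))); last exact/funext.
split; first exact: integD.
rewrite RintegralD// lerD2l RintegralD// Rintegral_sum; last first.
  by move=> i; exact: integ_history_increment.
rewrite big1 ?add0r; last by move=> i _; exact: Rintegral_history_increment.
rewrite Rintegral_sum//.
(* The squared Frobenius norm is the trace of the Gram matrix. *)
have -> : \int[P]_w (frobenius (A w) ^+ 2) = \sum_i \int[P]_w S i i w.
  rewrite -Rintegral_sum//; apply: eq_Rintegral => w _.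
  rewrite frobeniusE exchange_big/=.
  by apply: eq_bigr => i _; apply: eq_bigr => r _; rewrite expr2.
rewrite mulr_sumr; apply: ler_sum => i _.
rewrite Rintegral_sum => [|l]; last exact: integ_history_increment2.
rewrite (bigD1 i)//= [X in _ + X]big1 ?addr0; last first.
  by move=> l li; apply: Rintegral_history_increment2; rewrite // eq_sym.
apply: Rintegral_history_increment_sq => // w.
by apply: sumr_ge0 => r _; rewrite -expr2 sqr_ge0.
Qed.

End increment_moments.

(** * The Euler-Maruyama scheme *)

Section drift.
Context {R : realType} (n : nat).
Implicit Types x y : 'cV[R]_n.

Lemma enorm_sq_addZ x y (D : R) :
  enorm (x + D *: y) ^+ 2 =
  enorm x ^+ 2 + 2 * D * dotp x y + D ^+ 2 * enorm y ^+ 2.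
Proof.
rewrite !enormE /dotp !mulr_sumr -!big_split/=.
by apply: eq_bigr => i _; rewrite !mxE; ring.
Qed.

Lemma dotp_ge x y : - (enorm x ^+ 2 + enorm y ^+ 2) <= 2 * dotp x y.
Proof.
have := sqr_ge0 (enorm (x + 1 *: y)); rewrite enorm_sq_addZ; nra.
Qed.

Lemma enorm_sq_addZ_le x y (D : R) :
  enorm (x + D *: y) ^+ 2 <= 2 * enorm x ^+ 2 + 2 * D ^+ 2 * enorm y ^+ 2.
Proof.
have := sqr_ge0 (enorm (x + (- D) *: y)); rewrite !enorm_sq_addZ sqrrN; nra.
Qed.

End drift.

Section scheme.
Context {R : realType} (d m N : nat) (hN : (1 <= N)%N) {dO : measure_display}
  {Omega : measurableType dO} (P : probability Omega R).
Variables (F : R -> set (set Omega)) (W : R -> Omega -> 'cV[R]_m)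
  (X0 : Omega -> 'cV[R]_d).
Variables (Ws : 'I_N -> R -> Omega -> 'cV[R]_m)
  (X0s : 'I_N -> Omega -> 'cV[R]_d).
Variables (b : 'cV[R]_d -> P2 R d -> 'cV[R]_d)
  (sigma : 'cV[R]_d -> P2 R d -> 'M[R]_(d, m)).
Hypotheses (hbB : borel_coef b) (hsB : borel_coef sigma).
Hypothesis hF : usual_conditions P F.
Hypothesis hW : brownian_motion P F W.
Hypothesis hX0 : measurable_wrt (F 0) (X0 : Omega -> borel 'cV[R]_d).
Hypothesis hX02 : (\int[P]_w (enorm (X0 w) ^+ 2)%:E < +oo)%E.
Hypothesis hcopies :
  iid_copies P (driving W X0) (fun j => driving (Ws j) (X0s j)).
Variables (a1 a2 q b1 b2 : R).
Hypotheses (ha1 : 0 < a1) (hq : 2 <= q).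
Hypothesis coercive : forall (x : 'cV[R]_d) (mu : P2 R d),
  2 * dotp x (b x mu) + (q - 1) * frobenius (sigma x mu) ^+ 2
  <= - a1 * enorm x ^+ 2 + a2 * moment2 mu ^+ 2.
Hypothesis growth : forall (x : 'cV[R]_d) (mu : P2 R d),
  enorm (b x mu) ^+ 2 <= b1 * enorm x ^+ 2 + b2 * moment2 mu ^+ 2.
Variable (D : R).
Hypothesis D0 : 0 < D.
Local Notation integ f := (P.-integrable setT (EFin \o f)).
Local Notation H s := (g_sigma_algebraType (history_cylinders Ws X0s s)).
Local Notation Y := (euler_maruyama hN b sigma Ws X0s D).

(** Growth of sigma follows from (ii) once the inner product is bounded below by 2 <x, b> >= - |x|^2
    - |b|^2 and |b|^2 above by (iii). It supplies the integrability of sigma along the scheme. *)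
Lemma diffusion_le x mu : frobenius (sigma x mu) ^+ 2 <=
  (1 + b1) * enorm x ^+ 2 + (a2 + b2) * moment2 mu ^+ 2.
Proof.
have := coercive x mu; have := growth x mu; have := dotp_ge x (b x mu).
have := sqr_ge0 (frobenius (sigma x mu)); have := sqr_ge0 (enorm x).
set f := frobenius _ ^+ 2; set e := enorm x ^+ 2; move=> e0 f0 h1 h2 h3.
have q1 : 1 <= q - 1 by rewrite lerBrDr.
have : f <= (q - 1) * f by rewrite ler_peMl.
have : 0 <= a1 * e by rewrite mulr_ge0// ltW.
by lra.
Qed.

Lemma drift_diffusion_le x mu :
  enorm (x + D *: b x mu) ^+ 2 + D * frobenius (sigma x mu) ^+ 2 <=
  (1 - a1 * D + b1 * D ^+ 2) * enorm x ^+ 2 +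
  (a2 * D + b2 * D ^+ 2) * moment2 mu ^+ 2.
Proof.
rewrite enorm_sq_addZ.
have := coercive x mu; have := growth x mu.
have := sqr_ge0 (frobenius (sigma x mu)).
set f := frobenius _ ^+ 2; set e := enorm x ^+ 2; set g := enorm (b x mu) ^+ 2.
set M := moment2 mu ^+ 2; set p := dotp _ _ => f0 h1 h2.
have q1 : 1 <= q - 1 by rewrite lerBrDr.
have h3 : f <= (q - 1) * f by rewrite ler_peMl.
have h4 : D * (2 * p + f) <= D * (- a1 * e + a2 * M).
  by rewrite ler_wpM2l ?(ltW D0)//; lra.
have h5 : D ^+ 2 * g <= D ^+ 2 * (b1 * e + b2 * M).
  by rewrite ler_wpM2l ?sqr_ge0.
by lra.
Qed.

Let t_ (k : nat) := k%:R * D.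

Let t_ge0 k : 0 <= t_ k. Proof. by rewrite mulr_ge0// ltW. Qed.

Let t_lt k : t_ k < t_ k.+1. Proof. by rewrite ltr_pM2r// ltr_nat. Qed.

Let t_sub k : t_ k.+1 - t_ k = D.
Proof. by rewrite /t_ -mulrBl -natrB// subSnn mul1r. Qed.

Lemma measurable_history_mono s t (f : Omega -> R) : s <= t ->
  measurable_fun setT (f : H s -> R) -> measurable_fun setT (f : H t -> R).
Proof.
move=> st mf _ A mA; apply: (history_mono st).
exact: mf.
Qed.

Lemma measurable_history_W s u i r : 0 <= u <= s ->
  measurable_fun setT ((fun w => Ws i u w r 0) : H s -> R).
Proof.
move=> us _ A mA; rewrite setTI.
suff h : past s [set z : driving_space R m d | A (z.1 u r 0)].
  by have := @past_history R d m N _ Omega Ws X0s s i _ h.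
apply: sub_sigma_algebra; left.
exists u, ((fun x : 'cV[R]_m => x r 0) @^-1` A); split => //.
rewrite -[X in measurable X]setTI; exact: (measurable_coord r 0).
Qed.

Lemma measurable_history_X0 s i r :
  measurable_fun setT ((fun w => X0s i w r 0) : H s -> R).
Proof.
move=> _ A mA; rewrite setTI.
suff h : past s [set z : driving_space R m d | A (z.2 r 0)].
  by have := @past_history R d m N _ Omega Ws X0s s i _ h.
apply: sub_sigma_algebra; right.
exists ((fun x : 'cV[R]_d => x r 0) @^-1` A) => //.
rewrite -[X in measurable X]setTI; exact: (measurable_coord r 0).
Qed.

Lemma measurable_enorm_sq {dT} {T : measurableType dT} n (v : T -> 'cV[R]_n) :
  (forall r, measurable_fun setT (fun w => v w r 0)) ->
  measurable_fun setT (fun w => enorm (v w) ^+ 2).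
Proof.
move=> mv; under eq_fun do rewrite enormE.
by apply: measurable_sum => r; exact: measurable_funX.
Qed.

Lemma measurable_frobenius_sq {dT} {T : measurableType dT} n p
    (A : T -> 'M[R]_(n, p)) :
  (forall r i, measurable_fun setT (fun w => A w r i)) ->
  measurable_fun setT (fun w => frobenius (A w) ^+ 2).
Proof.
move=> mA; under eq_fun do rewrite frobeniusE.
apply: measurable_sum => r; apply: measurable_sum => i.
exact: measurable_funX.
Qed.

(** Sets depending only on the second component of a driving pair show that [X0s i] has the law of
    [X0], hence its second moment. *)
Lemma integ_X0 i : integ (fun w => enorm (X0s i w) ^+ 2).
Proof.
have mi : measurable_fun setT (X0s i : Omega -> borel 'cV[R]_d).
  apply: measurable_matrix => r c; rewrite ord1.
  apply: (history_measurable_fun hcopies (s := 0)).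
  exact: measurable_history_X0.
have m0 : measurable_fun setT (X0 : Omega -> borel 'cV[R]_d).
  move=> _ A mA; rewrite setTI; have [_ /(_ _ (lexx 0))[_ Fm] _ _ _] := hF.
  exact/Fm/hX0.
apply: integ_ge0 => [|w|].
- apply: measurable_enorm_sq => r.
  exact: (measurableT_comp (measurable_coord r 0) mi).
- exact: sqr_ge0.
pose f (x : borel 'cV[R]_d) : \bar R := (enorm (x : 'cV[R]_d) ^+ 2)%:E.
pose mim := isMeasurableFun.Build _ _ _ _ _ mi.
pose Xi : {mfun Omega >-> (borel 'cV[R]_d)} :=
  HB.pack (X0s i : Omega -> borel 'cV[R]_d) mim.
pose m0m := isMeasurableFun.Build _ _ _ _ _ m0.
pose X : {mfun Omega >-> (borel 'cV[R]_d)} :=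
  HB.pack (X0 : Omega -> borel 'cV[R]_d) m0m.
have mf : measurable_fun setT f by exact: measurable_enorm2.
have f0 x : (0 <= f x)%E by rewrite lee_fin sqr_ge0.
have <- : (\int[distribution P Xi]_x f x =
    \int[P]_w (enorm (X0s i w) ^+ 2)%:E)%E.
  exact: ge0_integral_distribution.
rewrite (eq_measure_integral (distribution P X)).
  by rewrite ge0_integral_distribution.
move=> A mA _; have [_ /(_ i [set z | A z.2]) h _] := hcopies.
apply: h; apply: sub_sigma_algebra; right; by exists A.
Qed.

Let mu k w := empirical_P2 hN (fun i => Y k i w).

(** The induction invariant concerns all particles at once, because the empirical measure makes each
    next position depend on every current one. *)
Definition adapted_sq_integrable k :=
  (forall i r, measurable_fun setT ((fun w => Y k i w r 0) : H (t_ k) -> R)) /\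
  (forall i, integ (fun w => enorm (Y k i w) ^+ 2)).

Lemma integ_moment2 k : adapted_sq_integrable k ->
  integ (fun w => moment2 (mu k w) ^+ 2).
Proof.
move=> [_ iY]; rewrite (_ : (fun _ => _) = fun w =>
  N%:R^-1 * \sum_i enorm (Y k i w) ^+ 2).
  by apply: integZ; exact: integ_sum.
by apply/funext => w; exact: moment2_empirical.
Qed.

(** The growth bounds turn integrability at step k into that of both coefficients, as
    [second_moment_step] requires. The coefficients belong to the history at t_k, and both endpoints
    of the increment to that at t_(k+1). *)
Lemma scheme_step k j : adapted_sq_integrable k ->
  [/\ forall r, measurable_fun setT
        ((fun w => Y k.+1 j w r 0) : H (t_ k.+1) -> R),
      integ (fun w => enorm (Y k.+1 j w) ^+ 2)
    & \int[P]_w (enorm (Y k.+1 j w) ^+ 2) <=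
      (1 - a1 * D + b1 * D ^+ 2) * \int[P]_w (enorm (Y k j w) ^+ 2) +
      (a2 * D + b2 * D ^+ 2) *
        (N%:R^-1 * \sum_i \int[P]_w (enorm (Y k i w) ^+ 2))].
Proof.
move=> Yk; have iM := integ_moment2 Yk; have [mY iY] := Yk.
pose beta w := b (Y k j w) (mu k w); pose S w := sigma (Y k j w) (mu k w).
pose v w := Y k j w + D *: beta w.
have mcoef p' (f : 'cV[R]_d -> P2 R d -> 'M[R]_(d, p')) r c : borel_coef f ->
    measurable_fun setT ((fun w => f (Y k j w) (mu k w) r c) : H (t_ k) -> R).
  move=> mf.
  have h := @measurable_coef R d N hN _ (H (t_ k)) d p' f
    (fun w i => Y k i w) j mf mY.
  exact: (measurableT_comp (measurable_coord r c) h).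
have mbeta r := mcoef _ _ r 0 hbB.
have mS r c := mcoef _ _ r c hsB.
have mv r : measurable_fun setT ((fun w => v w r 0) : H (t_ k) -> R).
  under eq_fun do rewrite !mxE.
  by apply: measurable_funD; [exact: mY|exact: measurable_funM].
have hist f :=
  @history_measurable_fun R d m N _ _ P W X0 Ws X0s hcopies (t_ k) f.
have iB : integ (fun w => enorm (beta w) ^+ 2).
  apply: integ_le (integD (integZ b1 (iY j)) (integZ b2 iM)) => [|w].
    by apply: measurable_enorm_sq => r; apply: hist; exact: mbeta.
  by rewrite ger0_norm ?sqr_ge0//; exact: growth.
have iS : integ (fun w => frobenius (S w) ^+ 2).
  apply: integ_le
    (integD (integZ (1 + b1) (iY j)) (integZ (a2 + b2) iM)) => [|w].
    by apply: measurable_frobenius_sq => r c; apply: hist; exact: mS.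
  by rewrite ger0_norm ?sqr_ge0//; exact: diffusion_le.
have iv : integ (fun w => enorm (v w) ^+ 2).
  apply: integ_le (integD (integZ 2 (iY j)) (integZ (2 * D ^+ 2) iB)) => [|w].
    by apply: measurable_enorm_sq => r; apply: hist; exact: mv.
  by rewrite ger0_norm ?sqr_ge0//; exact: enorm_sq_addZ_le.
have [iY1 leY1] :=
  second_moment_step hF hW hX0 hcopies j (t_ge0 k) (t_lt k) mv mS iv iS.
split=> [r||].
- rewrite /=.
  under eq_fun do rewrite mxE [X in _ + X]mxE.
  apply: measurable_funD.
    exact: (measurable_history_mono (ltW (t_lt k)) (mv r)).
  apply: measurable_sum => c; apply: measurable_funM.
    exact: (measurable_history_mono (ltW (t_lt k)) (mS r c)).
  under eq_fun do rewrite !mxE.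
  apply: measurable_funB; apply: measurable_history_W.
    by rewrite (t_ge0 k.+1) lexx.
  by rewrite (t_ge0 k) (ltW (t_lt k)).
- exact: iY1.
apply: le_trans leY1 _.
rewrite t_sub -RintegralZl// -RintegralD//; last exact: integZ.
(* The average of the second moments is the mean of the squared [moment2], so the claim reduces to
   the pointwise inequality [drift_diffusion_le]. *)
have -> : (1 - a1 * D + b1 * D ^+ 2) * \int[P]_w (enorm (Y k j w) ^+ 2) +
    (a2 * D + b2 * D ^+ 2) *
      (N%:R^-1 * \sum_i \int[P]_w (enorm (Y k i w) ^+ 2)) =
    \int[P]_w ((1 - a1 * D + b1 * D ^+ 2) * enorm (Y k j w) ^+ 2 +
      (a2 * D + b2 * D ^+ 2) * moment2 (mu k w) ^+ 2).
  rewrite RintegralD//; [|exact: integZ|exact: integZ].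
  rewrite !RintegralZl//; congr (_ + _ * _).
  under [RHS]eq_Rintegral do rewrite moment2_empirical.
  rewrite RintegralZl//; last exact: integ_sum.
  by rewrite Rintegral_sum.
apply: le_Rintegral => //.
- by apply: integD => //; exact: integZ.
- by apply: integD; exact: integZ.
by move=> w _; exact: drift_diffusion_le.
Qed.

Lemma scheme_adapted k : adapted_sq_integrable k.
Proof.
elim: k => [|k IH].
  split=> [i r|i]; first exact: measurable_history_X0.
  exact: integ_X0.
by split=> [i r|i]; have [h1 h2 _] := scheme_step i IH; first exact: h1.
Qed.

(** Summed over the particles, the averaged term gives back the total, so the two coefficients add
    up to 1 - T D. The comparison 1 - T D <= exp (- T D) holds whatever the sign of either side's
    argument. *)
Lemma scheme_total_decay k :
  \sum_i \int[P]_w (enorm (Y k i w) ^+ 2) <=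
  expR (- (a1 - a2 - (b1 + b2) * D) * (k%:R * D)) *
    \sum_i \int[P]_w (enorm (X0s i w) ^+ 2).
Proof.
elim: k => [|k IH]; first by rewrite mul0r mulr0 expR0 mul1r.
set T := a1 - a2 - (b1 + b2) * D in IH *.
pose e k' i := \int[P]_w (enorm (Y k' i w) ^+ 2).
have e0 k' i : 0 <= e k' i by apply: Rintegral_ge0 => w _; exact: sqr_ge0.
have N0 : N%:R != 0 :> R by rewrite pnatr_eq0 -lt0n.
have h : \sum_i e k.+1 i <= (1 - T * D) * \sum_i e k i.
  have -> : (1 - T * D) * \sum_i e k i =
      \sum_i ((1 - a1 * D + b1 * D ^+ 2) * e k i +
      (a2 * D + b2 * D ^+ 2) * (N%:R^-1 * \sum_l e k l)).
    have cst_sum (c x : R) : \sum_(i < N) c * (N%:R^-1 * x) = c * x.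
      by rewrite sumr_const card_ord -[LHS]mulr_natl mulrCA mulVKf.
    by rewrite big_split/= -mulr_sumr cst_sum /T; ring.
  by apply: ler_sum => i _; have [] := scheme_step i (scheme_adapted k).
apply: le_trans h _.
apply: le_trans (_ : expR (- T * D) * \sum_i e k i <= _).
  apply: ler_wpM2r; first by apply: sumr_ge0.
  by rewrite -mulNr expR_ge1Dx.
apply: le_trans (ler_wpM2l (expR_ge0 _) IH) _.
rewrite mulrA -expRD -natr1 [_ * D in leRHS]mulrDl mul1r [in leRHS]mulrDr.
by rewrite [X in expR X]addrC.
Qed.

End scheme.

(** * From decay of the moments to the exponential rate *)

Lemma limn_esup_lne_le {R : realType} (x : nat -> R) (C theta D : R) :
  0 < D -> 0 < C ->
  (forall k, x k <= expR (- theta * (k%:R * D)) * C) ->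
  (limn_esup (fun k => ((k%:R * D)^-1)%:E * lne (x k)%:E) <= (- theta)%:E)%E.
Proof.
move=> D0 C0 xC; apply/lee_addgt0Pr => e e0.
(* The logarithm of the bound, divided by k D, is - theta + ln C / (k D); beyond this n the last
   term is below e. *)
have [n nD] : exists n : nat, ln C < n%:R * (D * e).
  have De : 0 < D * e by rewrite mulr_gt0.
  exists (Num.bound `|ln C / (D * e)|).
  by rewrite -ltr_pdivrMr// (le_lt_trans (ler_norm _))// archi_boundP.
(* The strict inequality excludes k = 0, where the inverse of k D takes the default value 0. If
   [x k] is not positive, [lne] is -oo and the bound is immediate. *)
have ub k : (n < k)%N ->
    (((k%:R * D)^-1)%:E * lne (x k)%:E <= (- theta)%:E + e%:E)%E.
  move=> nk; have k0 : (0 : R) < k%:R by rewrite ltr0n (leq_ltn_trans _ nk).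
  have kD : 0 < k%:R * D by rewrite mulr_gt0.
  have [x0|x0] := leP (x k) 0.
    by rewrite le0_lneNy ?lee_fin// gt0_muleNy ?lte_fin ?invr_gt0// leNye.
  rewrite lne_EFin// -EFinM -EFinD lee_fin ler_pdivrMl//.
  have := xC k; rewrite -ler_ln ?posrE ?mulr_gt0 ?expR_gt0//.
  rewrite lnM ?posrE ?expR_gt0// expRK => /le_trans; apply.
  have : n%:R * (D * e) <= k%:R * (D * e).
    by rewrite ler_wpM2r ?mulr_ge0 ?ltW// ltr_nat.
  by nra.
rewrite /limn_esup limf_esupE.
apply: (@le_trans _ _ (ereal_sup
  ((fun k : nat => ((k%:R * D)^-1)%:E * lne (x k)%:E)%E
    @` [set k | (n < k)%N]))).
  by apply: ereal_inf_lbound; exists [set k | (n < k)%N] => //; exists n.+1.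
by apply: ub_ereal_sup => _ [k nk <-]; exact: ub.
Qed.

Theorem theorem4p2 (R : realType) (d m : nat)
  (dO : measure_display) (Omega : measurableType dO) (P : probability Omega R)
  (F : R -> set (set Omega)) (hF : usual_conditions P F)
  (b : 'cV[R]_d -> P2 R d -> 'cV[R]_d)
  (sigma : 'cV[R]_d -> P2 R d -> 'M[R]_(d, m))
  (hbB : borel_coef b) (hsB : borel_coef sigma)
  (hbL : locally_lipschitz_x b) (hsL : locally_lipschitz_x sigma)
  (W : R -> Omega -> 'cV[R]_m) (hW : brownian_motion P F W)
  (X0 : Omega -> 'cV[R]_d)
  (hX0 : measurable_wrt (F 0) (X0 : Omega -> borel 'cV[R]_d))
  (hX0_neq0 : ~ {ae P, forall w, X0 w = 0})
  (hX0_moments : forall p : R, 2 <= p ->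
     (\int[P]_w (enorm (X0 w) `^ p)%:E < +oo)%E)
  (N : nat) (hN : (1 <= N)%N)
  (Ws : 'I_N -> R -> Omega -> 'cV[R]_m) (X0s : 'I_N -> Omega -> 'cV[R]_d)
  (hcopies : iid_copies P (driving W X0) (fun j => driving (Ws j) (X0s j)))
  (K1 K2 : R) (hK1 : 0 < K1) (hK2 : 0 < K2)
  (cond_i : forall (x y : 'cV[R]_d) (mu nu : P2 R d),
     2 * dotp (x - y) (b x mu - b y nu)
       + frobenius (sigma x mu - sigma y nu) ^+ 2
     <= - K1 * enorm (x - y) ^+ 2 + K2 * W2 mu nu ^+ 2)
  (a1 a2 q : R) (ha1 : 0 < a1) (ha2 : 0 < a2) (hq : 2 <= q)
  (cond_ii : forall (x : 'cV[R]_d) (mu : P2 R d),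
     2 * dotp x (b x mu) + (q - 1) * frobenius (sigma x mu) ^+ 2
     <= - a1 * enorm x ^+ 2 + a2 * moment2 mu ^+ 2)
  (b1 b2 : R) (hb1 : 0 < b1) (hb2 : 0 < b2)
  (cond_iii : forall (x : 'cV[R]_d) (mu : P2 R d),
     enorm (b x mu) ^+ 2 <= b1 * enorm x ^+ 2 + b2 * moment2 mu ^+ 2)
  (ha : a2 < a1) :
  forall j : 'I_N,
    exists (Delta0 : R) (theta : R -> R),
      [/\ 0 < Delta0 < 1,
          theta Delta @[Delta --> 0^'+] --> a1 - a2
        & forall M : nat, (0 < M)%N ->
            let Delta : R := M%:R^-1 in
            Delta < Delta0 ->
            0 < theta Delta /\
            (limn_esup (fun k : nat =>
               ((k%:R * Delta)^-1)%:E *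
               lne 'E_P[fun w =>
                 (enorm (euler_maruyama hN b sigma Ws X0s Delta k j w) ^+ 2)%R])
             <= (- theta Delta)%:E)%E].
Proof.
move=> j.
have b12 : 0 < b1 + b2 by rewrite addr_gt0.
have a12 : 0 < a1 - a2 by rewrite subr_gt0.
pose theta (D : R) := a1 - a2 - (b1 + b2) * D.
(* [theta D] is positive exactly when D < (a1 - a2) / (b1 + b2); the minimum with 1/2 keeps the
   threshold below 1. *)
exists (Num.min 2^-1 ((a1 - a2) / (b1 + b2))), theta; split.
- by rewrite lt_min invr_gt0 ltr0n divr_gt0//= gt_min invf_lt1// ltr1n.
- apply: cvg_at_right_filter.
  rewrite -[X in _ --> X]subr0 -[X in _ - X](mulr0 (b1 + b2)).
  apply: cvgB; first exact: cvg_cst.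
  by apply: cvgM; [exact: cvg_cst|exact: cvg_id].
move=> M M0 D; rewrite lt_min => /andP[_ hD].
have D0 : 0 < D by rewrite invr_gt0 ltr0n.
split; first by rewrite /theta subr_gt0 -ltr_pdivlMl// mulrC.
have hX02 : (\int[P]_w (enorm (X0 w) ^+ 2)%:E < +oo)%E.
  have := hX0_moments 2 (lexx _).
  by under eq_integral do rewrite powR_mulrn ?sqrtr_ge0//.
pose Y := euler_maruyama hN b sigma Ws X0s D.
have Yint k : adapted_sq_integrable hN P Ws X0s b sigma D k.
  exact: (scheme_adapted hN hbB hsB hF hW hX0 hX02 hcopies ha1 hq cond_ii
    cond_iii D0).
pose e k := \int[P]_w (enorm (Y k j w) ^+ 2).
(* The summand 1 makes C positive at once, so that its logarithm can be used. *)
pose C := 1 + \sum_i \int[P]_w (enorm (X0s i w) ^+ 2).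
have S0 : 0 <= \sum_i \int[P]_w (enorm (X0s i w) ^+ 2).
  by apply: sumr_ge0 => i _; apply: Rintegral_ge0 => w _; exact: sqr_ge0.
have eC k : e k <= expR (- theta D * (k%:R * D)) * C.
  have := scheme_total_decay hN hbB hsB hF hW hX0 hX02 hcopies ha1 hq cond_ii
    cond_iii D0 k.
  rewrite (bigD1 j)//= => h.
  apply: le_trans (_ : e k <= expR (- theta D * (k%:R * D)) *
    \sum_i \int[P]_w (enorm (X0s i w) ^+ 2)) _.
    apply: le_trans h; rewrite lerDl; apply: sumr_ge0 => i _.
    by apply: Rintegral_ge0 => w _; exact: sqr_ge0.
  by rewrite ler_pM2l ?expR_gt0// lerDr.
(* The extended-valued expectation is finite by square integrability of the scheme, so it coincides
   with the real integral [e k]. *)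
rewrite (_ : (fun k : nat => _) =
  fun k => (((k%:R * D)^-1)%:E * lne (e k)%:E)%E).
  by apply: limn_esup_lne_le eC; rewrite // ltr_pwDl.
apply/funext => k; congr (_ * lne _)%E.
rewrite unlock /e /Rintegral fineK//.
exact: integrable_fin_num ((Yint k).2 j).
Qed.
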